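(* Let $X$ be an ultrahomogeneous chain with the discrete topology, and $G=(\mathrm{Aut}(X),\tau_{\partial})$. Then: (a) the map of compactifications $b_{b_mX}G\to b_{b^{\leftrightarrow}X}G$ of $G$ is elementary, and $$b_{b^{\leftrightarrow}X}G=b_{b_mX}G/0_K,\qquad 0_K=\{A_{\inf},A_{\sup}\},$$ where $A_{\inf}=(b_mX\times\{\inf\})\cup(\{\sup\}\times b_mX)$ and $A_{\sup}=(\{\inf\}\times b_mX)\cup(b_mX\times\{\sup\})$; (b) $b_{Y^-}G=b_{Y^+}G=b_{b_mX}G$; (c) $b_{Z^-}G=b_{Z^+}G=b_{b^{\updownarrow}X}G$; (d) $b_YG=b_{b^{\leftrightarrow}X}G$; (e) $b_ZG=b_{b^{+}X}G$; (f) $b_XG=b_{\alpha X}G$.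
   Context: A chain is an infinite linearly ordered set; $X$ is ultrahomogeneous if for every $n$ and all $x_1<\dots<x_n$, $y_1<\dots<y_n$ in $X$ there is an order automorphism $g\in\mathrm{Aut}(X)$ with $g(x_i)=y_i$. $\tau_\partial$ is the topology of pointwise convergence on $\mathrm{Aut}(X)$ for discrete $X$ (permutation topology). $b_mX$ is the compact linearly ordered space obtained from $X\times\{-1,0,1\}$ with the lexicographic order by adding a point for each gap, including the two improper gaps $\inf$ (least point) and $\sup$ (greatest point); gaps of $X\times\{-1,0,1\}$ and of $X$ are identified. $X$ is identified with the dense discrete subset $X\times\{0\}$, and the action of $G$ extends naturally. Quotient $G$-compactifications of $X$: $b^{\leftrightarrow}X$ is $b_mX$ with $\inf\sim\sup$; $b^{\updownarrow}X$ is $b_mX$ with $(x,-1)\sim(x,1)$ for every $x\in X$; $b^{+}X$ is $b_mX$ with both identifications; $\alpha X$ is the one-point compactification. Locally compact $G$-extensions of $X$: $Y^-=b_mX\setminus\{\sup\}$, $Y^+=b_mX\setminus\{\inf\}$, $Y=b_mX\setminus\{\inf,\sup\}$, $Z^-=b^{\updownarrow}X\setminus\{\sup\}$, $Z^+=b^{\updownarrow}X\setminus\{\inf\}$, $Z=b^{\updownarrow}X\setminus\{\inf,\sup\}$, and $X$. For each of these locally compact $G$-spaces $T$, $b_TG$ (graph compactification) is the closure of $\{\{(t,gt)\mid t\in T\}\mid g\in G\}$ in the space $2^{T\times T}$ of all closed subsets of $T\times T$ (including $\emptyset$) with the Fell topology, whose subbase is all sets $\{F\mid F\cap W\ne\emptyset\}$,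 $W$ open, and $\{F\mid F\cap C=\emptyset\}$, $C$ compact; $G$ is embedded by $g\mapsto\{(t,gt)\mid t\in T\}$. A map of compactifications of $G$ is a continuous map commuting with the embeddings of $G$; equality means that it is a homeomorphism. An onto quotient map is elementary if preimages of all points, except maybe one, are one-point sets; $b/0_K$ is the quotient collapsing $0_K$ to a point. *)

(* Defs.v *)
From Stdlib Require Import Relation_Operators.
From HB Require Import structures.
From mathcomp Require Import all_boot all_order all_algebra.
From mathcomp Require Import all_classical.
From mathcomp Require Import topology.

Set Implicit Arguments.
Unset Strict Implicit.
Unset Printing Implicit Defensive.

Import Order.TTheory.

Local Open Scope quotient_scope.
Local Open Scope order_scope.
Local Open Scope classical_set_scope.

Definition automorphism d (L : orderType d) (f : L -> L) : Prop :=
  bijective f /\ {mono f : x y / x <= y}.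

(* As a subspace of the product of discrete copies of L, Aut(L) carries the
   permutation topology. *)
Definition Aut d (L : orderType d) : Type :=
  set_type [set f : prod_topology (fun _ : L => discrete_topology L) |
            automorphism (f : L -> L)].

HB.instance Definition _ d (L : orderType d) :=
  Topological.copy (Aut L)
    (set_type [set f : prod_topology (fun _ : L => discrete_topology L) |
               automorphism (f : L -> L)]).

Definition aut_fun d (L : orderType d) (g : Aut L) : L -> L := set_val g.
Coercion aut_fun : Aut >-> Funclass.

Lemma autP d (L : orderType d) (g : Aut L) : automorphism g.
Proof. exact: set_valP g. Qed.

Definition ultrahomogeneous d (X : orderType d) : Prop :=
  forall (n : nat) (x y : 'I_n -> X),
    {homo x : i j / (i < j)%N >-> i < j} ->
    {homo y : i j / (i < j)%N >-> i < j} ->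
  exists g : Aut X, forall i, g (x i) = y i.

(* A gap is given by its lower part. The lower parts set0 and setT are the
   improper gaps inf and sup, which are allowed even if L has end points. *)
Definition gap d (L : orderType d) : set (set L) :=
  [set A | (forall x y, x <= y -> A y -> A x) /\
           [\/ A = set0, A = setT |
               (forall x, A x -> exists2 y, A y & x < y) /\
               (forall x, ~ A x -> exists2 y, ~ A y & y < x)]].

Definition gapcomp d (L : orderType d) : Type := (L + set_type (@gap d L))%type.

HB.instance Definition _ d (L : orderType d) := Choice.on (gapcomp L).

Fact gapcomp_display : Order.disp_t. Proof. exact: Order.Disp tt tt. Qed.

Section GapCompletion.
Context d (L : orderType d).
Implicit Types (A B : set_type (@gap d L)) (u v : gapcomp L).

Definition low A : set L := set_val A.

Definition gapcomp_le : rel (gapcomp L) := fun u v =>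
  match u, v with
  | inl p, inl q => p <= q
  | inl p, inr B => p \in low B
  | inr A, inl q => q \notin low A
  | inr A, inr B => `[< low A `<=` low B >]
  end.

Lemma lowP A : gap (low A).
Proof. exact: set_valP A. Qed.

Lemma low_down A x y : x <= y -> low A y -> low A x.
Proof. by have [+ _] := lowP A; exact. Qed.

Lemma low_inj : injective low.
Proof. by move=> A B AB; exact: val_inj. Qed.

Fact gapcomp_anti : antisymmetric gapcomp_le.
Proof.
move=> [p|A] [q|B] /=.
- by move=> /le_anti ->.
- by move=> /andP[->].
- by move=> /andP[/negP].
- by move=> /andP[/asboolP AB /asboolP BA]; congr inr; apply: low_inj;
    apply/seteqP.
Qed.

Fact gapcomp_trans : transitive gapcomp_le.
Proof.
move=> [q|B] [p|A] [r|C] //=.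
- exact: le_trans.
- by move=> pq /set_mem qC; apply/mem_set/(low_down pq).
- move=> /negP qA qr; apply/negP => /set_mem rA; apply: qA.
  exact/mem_set/(low_down qr).
- move=> /negP qA /set_mem qC; apply/asboolP => x Ax; apply: (low_down _ qC).
  by case: (leP x q) => // /ltW qx; case: qA; exact/mem_set/(low_down qx).
- move=> /set_mem pB /negP rB; case: (leP p r) => // /ltW rp.
  by case: rB; exact/mem_set/(low_down rp).
- by move=> /set_mem pB /asboolP BC; exact/mem_set/BC.
- by move=> /asboolP AB /negP rB; apply/negP => /set_mem /AB /mem_set.
- by move=> /asboolP AB /asboolP BC; apply/asboolP => x /AB /BC.
Qed.

Fact gapcomp_total : total gapcomp_le.
Proof.
move=> [p|A] [q|B] /=.
- exact: le_total.
- exact: orbN.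
- exact: orNb.
- have [AB|/existsNP[x /not_implyP[Ax nBx]]] := pselect (low A `<=` low B).
    by apply/orP; left; exact/asboolP.
  apply/orP; right; apply/asboolP => y By.
  case: (leP y x) => [yx|/ltW xy]; first exact: low_down Ax.
  by case: nBx; exact: low_down By.
Qed.

HB.instance Definition _ := Order.Le_isPOrder.Build gapcomp_display (gapcomp L)
  (fun u => match u return gapcomp_le u u with
    | inl p => lexx p
    | inr A => introT (asboolP _) (fun x Ax => Ax) end)
  gapcomp_anti gapcomp_trans.
HB.instance Definition _ :=
  Order.POrder_isTotal.Build gapcomp_display (gapcomp L) gapcomp_total.

Lemma gapcomp_leE u v : (u <= v) = gapcomp_le u v. Proof. by []. Qed.

Fact gap0 : gap (@set0 L).
Proof. by split=> //; constructor 1. Qed.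

Fact gapT : gap [set: L].
Proof. by split=> //; constructor 2. Qed.

Definition gc_inf : gapcomp L := inr (SigSub (mem_set gap0)).
Definition gc_sup : gapcomp L := inr (SigSub (mem_set gapT)).

Lemma gc_infP u : gc_inf <= u.
Proof.
rewrite gapcomp_leE; case: u => [p|A] /=; first by apply/negP => /set_mem.
by apply/asboolP => x.
Qed.

Lemma gc_supP u : u <= gc_sup.
Proof.
by rewrite gapcomp_leE; case: u => [p|A] /=; [exact/mem_set | exact/asboolP].
Qed.

End GapCompletion.
HB.instance Definition _ d (L : orderType d) :=
  OrderTopological.copy (gapcomp L) (order_topology (gapcomp L)).

Section GapCompactness.
Context d (L : orderType d).
Implicit Types (S : set (gapcomp L)) (u v : gapcomp L).

Lemma gapcomp_supremum S : (forall u v, u <= v -> S v -> S u) ->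
  exists2 s, (forall u, S u -> u <= s) & (forall u, u < s -> exists2 v, S v & u < v).
Proof.
move=> Sd.
have [Ssup|nSsup] := pselect (S (gc_sup L)).
  exists (gc_sup L); first by move=> u _; exact: gc_supP.
  by move=> u us; exists (gc_sup L).
pose A : set L := [set p | S (inl p)].
have Ad x y : x <= y -> A y -> A x by move=> xy; apply: Sd.
have nT B : S (inr B) -> low B <> setT.
  move=> SB BT; apply: nSsup; apply: Sd SB; rewrite gapcomp_leE /=.
  by apply/asboolP => x _; rewrite BT.
have SBA B : S (inr B) -> low B `<=` A.
  move=> SB p Bp; apply: Sd SB; rewrite gapcomp_leE /=; exact/mem_set.
have [A0|/eqP/set0P[a Aa]] := pselect (A = set0).
  exists (gc_inf L); last by move=> u; rewrite ltNge gc_infP.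
  move=> [p Sp|B SB]; first by have : A p by []; rewrite A0.
  rewrite gapcomp_leE /=; apply/asboolP => x Bx.
  by have := SBA _ SB _ Bx; rewrite A0.
have [[p Ap Amax]|nmax] := pselect (exists2 p, A p & forall q, A q -> q <= p).
  exists (inl p); last by move=> u up; exists (inl p).
  move=> [q /Amax//|B SB]; rewrite gapcomp_leE /=; apply/negP => /set_mem Bp.
  have [_ [B0|BT|[+ _]]] := lowP B.
  - by move: Bp; rewrite B0.
  - exact: nT SB BT.
  - move=> /(_ _ Bp)[q Bq]; rewrite ltNge => /negP; apply.
    exact/Amax/(SBA _ SB).
have Anmax x : A x -> exists2 y, A y & x < y.
  move=> Ax; apply: contrapT => h; apply: nmax; exists x => // y Ay.
  by rewrite leNgt; apply/negP => xy; apply: h; exists y.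
have [[q nAq qmin]|nmin] :=
    pselect (exists2 q, ~ A q & forall r, ~ A r -> q <= r).
  exists (inl q).
    move=> [r Sr|B SB]; rewrite gapcomp_leE /=.
      by rewrite leNgt; apply/negP => /ltW rq; apply/nAq/(Ad _ _ _ Sr).
    by apply/negP => /set_mem /(SBA _ SB).
  have Alt r : r < q -> A r.
    by move=> rq; apply: contrapT => /qmin; rewrite leNgt rq.
  move=> [r|B].
    rewrite ltNge gapcomp_leE /= -ltNge => rq; have [|y Ay ry] := Anmax r; first exact: Alt.
    by exists (inl y); rewrite // ltNge gapcomp_leE /= -ltNge.
  rewrite ltNge gapcomp_leE /= => /negP nBq.
  have nBq' : ~ low B q by move=> Bq; apply: nBq; exact/mem_set.
  have : ~ (A `<=` low B).
    move=> AB; have [Bd [B0|BT|[_ Bmin]]] := lowP B.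
    - by have := AB _ Aa; rewrite B0.
    - by apply: nBq'; rewrite BT.
    - have [y nBy yq] := Bmin _ nBq'; apply: nBy; apply: AB; exact: Alt.
  move=> /existsNP[r /not_implyP[Ar nBr]]; exists (inl r) => //.
  by rewrite ltNge gapcomp_leE /=; apply/negP => /set_mem.
have gA : gap A.
  split=> //; constructor 3; split=> // x nAx.
  apply: contrapT => h; apply: nmin; exists x => // r nAr.
  by rewrite leNgt; apply/negP => rx; apply: h; exists r.
exists (inr (SigSub (mem_set gA))).
  move=> [r Sr|B SB]; rewrite gapcomp_leE /=; first exact/mem_set.
  exact/asboolP/SBA.
move=> [r|B]; rewrite ltNge gapcomp_leE /=.
  move=> /negPn/set_mem Ar; have [y Ay ry] := Anmax _ Ar.
  by exists (inl y); rewrite // ltNge gapcomp_leE /= -ltNge.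
move=> /negP h; have : ~ (A `<=` low B) by move=> ?; apply/h/asboolP.
move=> /existsNP[r /not_implyP[Ar nBr]]; exists (inl r) => //.
by rewrite ltNge gapcomp_leE /=; apply/negP => /set_mem.
Qed.

Lemma gapcomp_compact : compact [set: gapcomp L].
Proof.
rewrite compact_ultra => F FU _.
have [u v uv Fv|s sub sup] :=
    @gapcomp_supremum [set u | F [set w | u <= w]].
  by apply: filterS Fv => w; exact: le_trans.
exists s; split=> // U; rewrite /= itv_nbhsE => -[i [oi si] iU].
apply: filterS iU _.
have Fl u : u < s -> F [set w | u < w].
  move=> us; have [v /= Fv uv] := sup u us; apply: filterS Fv => w.
  exact: lt_le_trans.
have Fr u : s < u -> F [set w | w < u].
  move=> su; have [|Fu] := in_ultra_setVsetC [set w | u <= w] FU.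
    by move=> /sub; rewrite leNgt su.
  by apply: filterS Fu => w /negP; rewrite -ltNge.
case: i oi si => [[[] a|[]]] [[] b|[]] // _ /itvP si.
- have as_ : a < s by rewrite si.
  have sb : s < b by rewrite si.
  apply: filterS (filterI (Fl _ as_) (Fr _ sb)).
  by move=> w [/= aw wb]; rewrite in_itv /= aw.
- have as_ : a < s by rewrite si.
  by apply: filterS (Fl _ as_) => w /= aw; rewrite in_itv /= aw.
- have sb : s < b by rewrite si.
  by apply: filterS (Fr _ sb) => w /= wb; rewrite in_itv /= wb.
- by apply: filterS filterT => w _; rewrite set_itvE.
Qed.

End GapCompactness.

Section GapAction.
Context d (L : orderType d).

Lemma automorphism_inv (f : L -> L) : automorphism f ->
  exists2 h, automorphism h & cancel f h /\ cancel h f.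
Proof.
move=> [[h fh hf] fmono]; exists h => //; split; first by exists f.
by move=> x y; rewrite -{2}(hf x) -{2}(hf y) fmono.
Qed.

Lemma automorphism_lt (f : L -> L) : automorphism f -> {mono f : x y / x < y}.
Proof. by move=> [_ /leW_mono]. Qed.

Fact gap_image (f : L -> L) (A : set L) : automorphism f -> gap A ->
  gap (f @` A).
Proof.
move=> af [Ad Ag]; have [h ah [fh hf]] := automorphism_inv af.
have imE x : (f @` A) x <-> A (h x).
  by split=> [[y Ay <-]|Ahx]; [rewrite fh | exists (h x)].
split=> [x y xy /imE Ay|].
  by apply/imE; apply: Ad Ay; case: ah => _ ->.
case: Ag => [->|->|[Amax Amin]].
- by constructor 1; rewrite image_set0.
- by constructor 2; apply/seteqP; split=> // x _; exists (h x).
- constructor 3; split=> x.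
  + move=> /imE/Amax[y Ay xy]; exists (f y); first by exists y.
    by rewrite -(hf x) automorphism_lt.
  + move=> nx; have [|y nAy xy] := Amin (h x); first by move/imE.
    exists (f y); first by move/imE; rewrite fh.
    by rewrite -(hf x) automorphism_lt.
Qed.

Definition gapcomp_act (g : Aut L) (u : gapcomp L) : gapcomp L :=
  match u with
  | inl p => inl (g p)
  | inr A => inr (SigSub (mem_set (gap_image (autP g) (lowP A))))
  end.

Lemma gapcomp_act_mono (g : Aut L) : {mono gapcomp_act g : u v / u <= v}.
Proof.
have [gb gm] := autP g; have gi := bij_inj gb.
have imE (A : set L) x : (g x \in g @` A) = (x \in A).
  apply/idP/idP => /set_mem; last by move=> Ax; apply/mem_set; exists x.
  by move=> [y Ay /gi <-]; exact/mem_set.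
move=> [p|A] [q|B]; rewrite !gapcomp_leE /=.
- exact: gm.
- exact: imE.
- by rewrite imE.
- apply/asboolP/asboolP; last exact: image_subset.
  move=> AB x Ax; have /AB : (g @` low A) (g x) by exists x.
  by move=> [y By /gi <-].
Qed.

Lemma gapcomp_act_surj (g : Aut L) v : exists u, gapcomp_act g u = v.
Proof.
have [h ah [gh hg]] := automorphism_inv (autP g).
case: v => [p|B]; first by exists (inl (h p)) => /=; rewrite hg.
exists (inr (SigSub (mem_set (gap_image ah (lowP B))))) => /=.
congr inr; apply: low_inj; apply/seteqP; split=> x /=.
  by move=> [_ [y By <-] <-]; rewrite hg.
by move=> Bx; exists (h x) => //; exists x.
Qed.

Lemma gapcomp_act_inf (g : Aut L) : gapcomp_act g (gc_inf L) = gc_inf L.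
Proof.
have [u uE] := gapcomp_act_surj g (gc_inf L).
by apply/le_anti; rewrite gc_infP ?andbT -{2}uE gapcomp_act_mono gc_infP.
Qed.

Lemma gapcomp_act_sup (g : Aut L) : gapcomp_act g (gc_sup L) = gc_sup L.
Proof.
have [u uE] := gapcomp_act_surj g (gc_sup L).
by apply/le_anti; rewrite gc_supP ?andbT -{1}uE gapcomp_act_mono gc_supP.
Qed.

Lemma gapcomp_act_continuous (g : Aut L) : continuous (gapcomp_act g).
Proof.
have gm := gapcomp_act_mono g; have glt := leW_mono gm.
move=> u U; rewrite /= itv_nbhsE => -[i [oi ui] iU].
suff : nbhs u (gapcomp_act g @^-1` [set` i]).
  by apply: filterS => w; exact: iU.
case: i oi ui {iU} => [[[] a|[]]] [[] b|[]] // _ ui.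
- have [a' aE] := gapcomp_act_surj g a.
  have [b' bE] := gapcomp_act_surj g b.
  have -> : gapcomp_act g @^-1` [set` (`]a, b[)%O] = `]a', b'[%classic.
    by apply/seteqP; split=> w; rewrite /= !in_itv /= -aE -bE !glt.
  apply: open_nbhs_nbhs; split; first exact: itv_open.
  by move: ui; rewrite /= !in_itv /= -aE -bE !glt.
- have [a' aE] := gapcomp_act_surj g a.
  have -> : gapcomp_act g @^-1` [set` (`]a, +oo[)%O] = `]a', +oo[%classic.
    by apply/seteqP; split=> w; rewrite /= !in_itv /= -aE !glt.
  apply: open_nbhs_nbhs; split; first exact: rray_open.
  by move: ui; rewrite /= !in_itv /= -aE !glt.
- have [b' bE] := gapcomp_act_surj g b.
  have -> : gapcomp_act g @^-1` [set` (`]-oo, b[)%O] = `]-oo, b'[%classic.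
    by apply/seteqP; split=> w; rewrite /= !in_itv /= -bE !glt.
  apply: open_nbhs_nbhs; split; first exact: lray_open.
  by move: ui; rewrite /= !in_itv /= -bE !glt.
- by rewrite set_itvE preimage_setT; exact: filterT.
Qed.

End GapAction.

Lemma diag_closed (T : topologicalType) : hausdorff_space T ->
  closed [set p : T * T | p.1 = p.2].
Proof.
move=> hT [a b] cab /=; apply: hT => U V aU bV.
have [|[x y] /= [-> [Ux Vx]]] := cab (U `*` V); first by exists (U, V).
by exists y.
Qed.

Section Quotient.
Context (T : topologicalType) (r : T -> T -> Prop).

Local Notation eqv_gen := (clos_refl_sym_trans T r).

Definition eqv_genb : rel T := fun x y => `[< eqv_gen x y >].

Fact eqv_genb_equiv : equiv_class_of eqv_genb.
Proof.
split=> [x|x y|y x z]; first exact/asboolP/rst_refl.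
- by apply/asboolP/asboolP; exact: rst_sym.
- by move=> /asboolP xy /asboolP yz; exact/asboolP/(rst_trans _ _ _ _ _ xy yz).
Qed.

Canonical eqv_gen_rel := EquivRelPack eqv_genb_equiv.

(* T modulo the least equivalence relation containing r. *)
Definition quot : topologicalType := quotient_topology {eq_quot eqv_gen_rel}.

Definition qpi (x : T) : quot := \pi_{eq_quot eqv_gen_rel} x.

Lemma qpiP x y : qpi x = qpi y <-> eqv_gen x y.
Proof.
split; first by move=> /eqquotP/asboolP.
by move=> xy; apply/eqquotP/asboolP.
Qed.

Lemma qpi_surj (a : quot) : exists x, qpi x = a.
Proof. by exists (repr a); rewrite /qpi reprK. Qed.

Lemma qpi_continuous : continuous qpi.
Proof. exact: pi_continuous. Qed.

Lemma quot_open (U : set quot) : open U = open (qpi @^-1` U).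
Proof. by []. Qed.

Lemma quot_hausdorff : compact [set: T] -> hausdorff_space T ->
  closed [set p : T * T | eqv_gen p.1 p.2] -> hausdorff_space quot.
Proof.
move=> cT hT cE.
pose sat (C : set T) := [set y | exists2 x, C x & eqv_gen x y].
have sat_closed C : closed C -> closed (sat C).
  move=> cC; have -> : sat C =
      snd @` ([set p : T * T | eqv_gen p.1 p.2] `&` fst @^-1` C).
    apply/seteqP; split=> [y [x Cx xy]|_ [[x y] [/= xy Cx] <-]].
      by exists (x, y).
    by exists x.
  apply: compact_closed => //; apply: continuous_compact.
    by apply: continuous_subspaceT => x; exact: cvg_snd.
  apply: (subclosed_compact _ (compact_setX cT cT)) => //.
  apply: closedI => //; apply: preimage_closed => // x _; exact: cvg_fst.
rewrite open_hausdorff => a b /eqP ab.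
have [x xa] := qpi_surj a; have [y yb] := qpi_surj b.
have nxy : ~ eqv_gen x y by rewrite -qpiP xa yb.
have c1 (z : T) : closed [set z].
  exact/accessible_closed_set1/hausdorff_accessible.
have nU : set_nbhs (sat [set x]) (~` sat [set y]).
  move=> z [_ -> xz]; apply: open_nbhs_nbhs; split.
    exact/closed_openC/sat_closed.
  move=> [_ -> yz]; apply: nxy; apply: rst_trans xz _; exact: rst_sym.
have [V xV Vy] := compact_normal hT cT (sat_closed _ (c1 x)) nU.
pose P := ~` sat (~` V^°); pose Q := ~` sat (closure V).
have sat_pre C : closed C -> open (qpi @` (~` sat C)).
  move=> cC; rewrite quot_open (_ : qpi @^-1` _ = ~` sat C).
    exact/closed_openC/sat_closed.
  apply/seteqP; split=> [z [w nw /qpiP wz]|z nz]; last by exists z.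
  by move=> [c Cc cz]; apply: nw; exists c => //; apply: rst_trans cz (rst_sym _ _ _ _ wz).
exists (qpi @` P, qpi @` Q); split => /=.
- apply/mem_set; exists x => // -[c cV cx]; apply: cV.
  by apply: xV; exists x => //; exact: rst_sym.
- apply/mem_set; exists y => // -[c cV cy]; apply: (Vy _ cV).
  by exists y => //; exact: rst_sym.
- by apply: sat_pre; apply: open_closedC; exact: open_interior.
- by apply: sat_pre; exact: closed_closure.
apply/eqP; rewrite -subset0 => _ [[z Pz <-] [w Qw /qpiP wz]].
apply: Qw; exists z; last exact: rst_sym.
apply: subset_closure; apply: interior_subset.
by apply: contrapT => nz; apply: Pz; exists z => //; exact: rst_refl.
Qed.

End Quotient.

(* These fields are only what makes the graphs {(t, g t)} closed; that the
   concrete maps gact below are actions of Aut X is seen from their formulas. *)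
Record gspace (G : Type) := GSpace {
  gcarrier :> topologicalType;
  gact : G -> gcarrier -> gcarrier;
  gact_continuous : forall g, continuous (gact g);
  gspace_hausdorff : hausdorff_space gcarrier }.

Section SubSpace.
Context (G : Type) (T : gspace G) (A : set T).
Hypothesis Ainv : forall g x, A x -> A (gact g x).

Definition sub_act (g : G) (x : set_type A) : set_type A :=
  SigSub (mem_set (Ainv g (set_valP x))).

Fact sub_act_continuous g : continuous (sub_act g).
Proof.
apply: continuous_comp_initial => x.
apply: (@continuous_comp _ _ _ set_val (gact g)); first exact: initial_continuous.
exact: gact_continuous.
Qed.

Fact sub_hausdorff : hausdorff_space (set_type A).
Proof.
move=> x y xy; apply: val_inj; apply: (@gspace_hausdorff _ T).
move=> U V Ux Vy.
have cv : continuous (set_val : set_type A -> T) by exact: initial_continuous.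
by have [z [Uz Vz]] := xy _ _ (cv x _ Ux) (cv y _ Vy); exists (set_val z).
Qed.

Definition sub_gspace : gspace G :=
  GSpace sub_act_continuous sub_hausdorff.

End SubSpace.

Section QuotSpace.
Context (G : Type) (T : gspace G) (r : T -> T -> Prop).
Hypothesis rinv : forall g x y, r x y -> r (gact g x) (gact g y).
Hypothesis cT : compact [set: T].
Hypothesis cr : closed [set p : T * T | clos_refl_sym_trans T r p.1 p.2].

Definition quot_act (g : G) (a : quot r) : quot r := qpi r (gact g (repr a)).

Lemma quot_actE g x : quot_act g (qpi r x) = qpi r (gact g x).
Proof.
have gE u v : clos_refl_sym_trans T r u v ->
    clos_refl_sym_trans T r (gact g u) (gact g v).
  elim=> {u v} [u v /(rinv g)|u|u v _|u v w _ + _].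
  - exact: rst_step.
  - exact: rst_refl.
  - exact: rst_sym.
  - exact: rst_trans.
by apply/qpiP/gE/qpiP; rewrite /qpi reprK.
Qed.

Fact quot_act_continuous g : continuous (quot_act g).
Proof.
apply/quotient_continuous => x.
rewrite (_ : _ \o _ = qpi r \o gact g); last by apply/funext => y; exact: quot_actE.
apply: continuous_comp; first exact: gact_continuous.
exact: qpi_continuous.
Qed.

Definition quot_gspace : gspace G := GSpace quot_act_continuous
  (quot_hausdorff cT (@gspace_hausdorff _ T) cr).

End QuotSpace.

Section Hyperspace.
Context (E : topologicalType).

Definition hyperspace : Type := set_type [set F : set E | closed F].

HB.instance Definition _ := Choice.on hyperspace.

Definition hset (F : hyperspace) : set E := set_val F.

Definition fell_subbase : set (set hyperspace) :=
  [set U | (exists2 W : set E, open W &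
              U = [set F | hset F `&` W !=set0]) \/
           (exists2 C : set E, compact C &
              U = [set F | hset F `&` C = set0])].

HB.instance Definition _ :=
  isSubBaseTopological.Build hyperspace fell_subbase id.

End Hyperspace.

Arguments fell_subbase E _ : clear implicits.

Record extension (G : Type) := Extension {
  ext_space :> topologicalType;
  ext_emb : G -> ext_space }.

Section GraphCompactification.
Context (G : Type) (T : gspace G).

Definition graph (g : G) : set (T * T) := [set p | p.2 = gact g p.1].

Fact graph_closed g : closed (graph g).
Proof.
rewrite (_ : graph g = (fun p => (p.2, gact g p.1)) @^-1` [set p | p.1 = p.2]) //.
apply: preimage_closed; last exact/diag_closed/gspace_hausdorff.
move=> p _; apply: cvg_pair; first exact: cvg_snd.
apply: (@continuous_comp _ _ _ fst (gact g)); first exact: cvg_fst.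
exact: gact_continuous.
Qed.

Definition graph_emb (g : G) : hyperspace (T * T)%type :=
  SigSub (mem_set (@graph_closed g)).

Definition graph_space : topologicalType :=
  set_type (closure (range graph_emb)).

Fact graph_emb_closure g : closure (range graph_emb) (graph_emb g).
Proof. by apply: subset_closure; exists g. Qed.

Definition graph_comp : extension G :=
  @Extension G graph_space (fun g => SigSub (mem_set (@graph_emb_closure g))).

End GraphCompactification.

Section Chain.
Context d (X : orderType d).
Local Notation X3 := (X *l 'I_3).

(* 'I_3 is used for {-1, 0, 1}. *)
Definition sneg : 'I_3 := @Ordinal 3 0 isT.
Definition snul : 'I_3 := @Ordinal 3 1 isT.
Definition spos : 'I_3 := @Ordinal 3 2 isT.

Definition aut3_fun (g : Aut X) (p : X3) : X3 := (g p.1, p.2).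

Fact aut3_proof (g : Aut X) : automorphism (aut3_fun g).
Proof.
have [h ah [gh hg]] := automorphism_inv (autP g).
split; first by exists (fun p : X3 => (h p.1, p.2)) => -[x s];
  rewrite /aut3_fun /= ?gh ?hg.
move=> [x s] [y t]; rewrite /aut3_fun /= !lexi_pair.
by have [_ gm] := autP g; rewrite !gm.
Qed.

Definition aut3 (g : Aut X) : Aut X3 := SigSub (mem_set (aut3_proof g)).

Definition bm : gspace (Aut X) :=
  GSpace (fun g => @gapcomp_act_continuous _ X3 (aut3 g))
         (@order_hausdorff _ (gapcomp X3)).

Definition bpt (x : X) (s : 'I_3) : bm := inl ((x, s) : X3).
Lemma bpt_inj x y s t : bpt x s = bpt y t -> x = y.
Proof. by rewrite /bpt => -[]. Qed.

Lemma bpt_neq x y s t : s != t -> bpt x s <> bpt y t.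
Proof. by rewrite /bpt => /eqP st []. Qed.

Definition binf : bm := gc_inf X3.
Definition bsup : bm := gc_sup X3.

Lemma bm_act_inf g : gact g binf = binf.
Proof. exact: gapcomp_act_inf. Qed.

Lemma bm_act_sup g : gact g bsup = bsup.
Proof. exact: gapcomp_act_sup. Qed.

Lemma bm_act_inj g : injective (gact g : bm -> bm).
Proof. exact: (inc_inj (@gapcomp_act_mono _ _ (aut3 g))). Qed.

Lemma bm_compact : compact [set: bm].
Proof. exact: gapcomp_compact. Qed.

Definition r_ends (u v : bm) : Prop := u = binf /\ v = bsup.
Definition r_twins (u v : bm) : Prop :=
  exists x, u = bpt x sneg /\ v = bpt x spos.
Definition r_both (u v : bm) : Prop := r_ends u v \/ r_twins u v.

Lemma r_ends_inv g u v : r_ends u v -> r_ends (gact g u) (gact g v).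
Proof. by move=> [-> ->]; split; [exact: bm_act_inf | exact: bm_act_sup]. Qed.

Lemma r_twins_inv g u v : r_twins u v -> r_twins (gact g u) (gact g v).
Proof. by move=> [x [-> ->]]; exists (g x). Qed.

Lemma r_both_inv g u v : r_both u v -> r_both (gact g u) (gact g v).
Proof. by case=> [/r_ends_inv|/r_twins_inv]; [left | right]. Qed.

Let E_ends (u v : bm) := (u = binf \/ u = bsup) /\ (v = binf \/ v = bsup).
Let E_twins (u v : bm) := r_twins u v \/ r_twins v u.

Lemma between_twins (x : X) (w : gapcomp X3) :
  bpt x sneg < w -> w < bpt x spos -> w = bpt x snul.
Proof.
case: w => [[y t]|A]; rewrite !ltNge !gapcomp_leE /=.
  rewrite -!ltNge !ltxi_pair.
  case: (ltgtP x y) => //= -> ; case: t => -[|[|[|//]]] //= t3 _ _.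
  by congr (inl (_, _)); exact: val_inj.
move=> /negPn/set_mem Am /negP Ap.
have nAp : ~ low A (x, spos) by move=> ?; apply: Ap; exact/mem_set.
have [Ad [A0|AT|[Amax Amin]]] := lowP A.
- by move: Am; rewrite A0.
- by case: nAp; rewrite AT.
have [A0|nA0] := pselect (low A ((x, snul) : X3)).
  have [[y t] Ay] := Amax _ A0; rewrite ltxi_pair => xy; case: nAp.
  apply: Ad Ay; move: xy; rewrite lexi_pair.
  by case: (ltgtP x y) => //= _; case: t => -[|[|[|//]]].
have [[y t] nAy] := Amin _ nA0; rewrite ltxi_pair => yx; case: nAy.
apply: Ad Am; move: yx; rewrite lexi_pair.
by case: (ltgtP x y) => //= _; case: t => -[|[|[|//]]].
Qed.

Lemma lt_twins (x : X) (s t : 'I_3) :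
  ((bpt x s : gapcomp X3) < bpt x t) = (s < t)%N.
Proof. by rewrite ltNge gapcomp_leE /= -ltNge ltxi_pair lexx. Qed.

Lemma center_open (x : X) : open [set bpt x snul].
Proof.
rewrite (_ : [set _] = `]bpt x sneg, bpt x spos[%classic); first exact: itv_open.
apply/seteqP; split=> w /=; rewrite in_itv /=.
  by move=> ->; rewrite !lt_twins.
by move=> /andP[]; exact: between_twins.
Qed.

Let twin_nulL x v : ~ r_twins (bpt x snul) v.
Proof. by move=> [y [e _]]; exact: (@bpt_neq x y snul sneg isT e). Qed.

Let twin_nulR x u : ~ r_twins u (bpt x snul).
Proof. by move=> [y [_ e]]; exact: (@bpt_neq x y snul spos isT e). Qed.

Let E_twins_lt (u v : gapcomp X3) : u < v -> ~ r_twins u v ->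
  (forall x, u <> bpt x snul) -> (forall x, v <> bpt x snul) ->
  exists a b : gapcomp X3, [/\ u < b, a < v &
    forall u' v', u' < b -> a < v' -> u' < v' /\ ~ r_twins u' v'].
Proof.
move=> uv nt nu nv.
have [[w [uw wv nw]]|nB] :=
    pselect (exists w, [/\ u < w, w < v & forall x, w <> bpt x snul]).
  exists w, w; split=> // u' v' u'w wv'; split; first exact: lt_trans wv'.
  move=> [x [u'E v'E]]; apply: (nw x); apply: between_twins.
    by rewrite -u'E.
  by rewrite -v'E.
have nB' : ~ exists w, u < w < v.
  move=> [w /andP[uw wv]].
  have [x wE] : exists x, w = bpt x snul.
    apply: contrapT => h; apply: nB; exists w; split=> // x wx.
    by apply: h; exists x.
  apply: nt; exists x; split; apply: contrapT => h.
    apply: nB; exists (bpt x sneg); split=> //.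
    - rewrite lt_neqAle; apply/andP; split; first exact/eqP.
      rewrite leNgt; apply/negP => hu; apply: (nu x); apply: between_twins => //.
      by apply: (lt_trans uw); rewrite wE lt_twins.
    - by apply: lt_trans wv; rewrite wE lt_twins.
  apply: nB; exists (bpt x spos); split=> //.
  - by apply: (lt_trans uw); rewrite wE lt_twins.
  - rewrite lt_neqAle; apply/andP; split; first by apply/eqP => /esym.
    rewrite leNgt; apply/negP => hv; apply: (nv x); apply: between_twins => //.
    by apply: lt_trans wv; rewrite wE lt_twins.
exists u, v; split=> // u' v' u'v uv'.
have u'u : u' <= u.
  by rewrite leNgt; apply/negP => uu'; apply: nB'; exists u'; rewrite uu'.
have vv' : v <= v'.
  by rewrite leNgt; apply/negP => v'v; apply: nB'; exists v'; rewrite uv'.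
split; first exact: le_lt_trans uv'.
move=> [x [u'E v'E]].
have [uc|cu] := ltP u (bpt x snul).
  have [cv|vc] := ltP (bpt x snul : gapcomp X3) v.
    by apply: nB'; exists (bpt x snul); rewrite uc.
  apply: (nv x); apply: between_twins.
    by rewrite -u'E.
  by apply: le_lt_trans vc _; rewrite lt_twins.
apply: (nu x); apply: between_twins.
  by apply: lt_le_trans cu; rewrite lt_twins.
by apply: lt_le_trans uv _; rewrite -v'E.
Qed.

Let twins_lt (u v : gapcomp X3) : r_twins u v -> u < v.
Proof. by move=> [x [-> ->]]; rewrite lt_twins. Qed.

Let twins_closed : closed [set p : bm * bm | p.1 = p.2 \/ E_twins p.1 p.2].
Proof.
pose R := [set p : bm * bm | p.1 = p.2 \/ E_twins p.1 p.2].
suff H (u v : gapcomp X3) : ~ R (u, v) ->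
    exists2 UV : set bm * set bm, (nbhs u UV.1 /\ nbhs v UV.2) &
      forall u' v', UV.1 u' -> UV.2 v' -> ~ R (u', v').
  rewrite -[X in closed X]setCK; apply: open_closedC; rewrite openE => -[u v] nR.
  have [[U V] /= nUV h] := H _ _ nR; exists (U, V) => // -[u' v'] /= [].
  exact: h.
have centre (x : X) (w : bm) : w <> bpt x snul -> open_nbhs w [set~ bpt x snul].
  move=> wx; split=> //; apply: closed_openC.
  exact/accessible_closed_set1/hausdorff_accessible/gspace_hausdorff.
move=> nR.
have [[x ux]|nu] := pselect (exists x, u = bpt x snul).
  exists ([set bpt x snul], [set~ bpt x snul]).
    split; apply: open_nbhs_nbhs; first by split; [exact: center_open|].
    by apply: centre => vx; apply: nR; left; rewrite ux vx.
  by move=> u' v' /= -> v'x [/esym //|[/twin_nulL|/twin_nulR]].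
have [[x vx]|nv] := pselect (exists x, v = bpt x snul).
  exists ([set~ bpt x snul], [set bpt x snul]).
    split; apply: open_nbhs_nbhs; last by split; [exact: center_open|].
    by apply: centre => ux; apply: nR; left; rewrite ux vx.
  by move=> u' v' /= u'x -> [//|[/twin_nulR|/twin_nulL]].
have nu' x : u <> bpt x snul by move=> ux; apply: nu; exists x.
have nv' x : v <> bpt x snul by move=> vx; apply: nv; exists x.
have [uv|vu|uv] := ltgtP u v.
- have [|a [b [ub av h]]] := E_twins_lt uv _ nu' nv'.
    by move=> t; apply: nR; right; left.
  exists (`]-oo, b[%classic, `]a, +oo[%classic).
    split; apply: open_nbhs_nbhs; split.
    - exact: (@lray_open _ (gapcomp X3)).
    - by rewrite /= in_itv /= ?andbT.
    - exact: (@rray_open _ (gapcomp X3)).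
    - by rewrite /= in_itv /= ?andbT.
  move=> u' v'; rewrite /= !in_itv /= andbT => u'b av'.
  have [lt nt] := h _ _ u'b av'; move=> [/= E|[//|/twins_lt]].
    by move: lt; rewrite E ltxx.
  by move=> /(lt_trans lt); rewrite ltxx.
- have [|a [b [vb au h]]] := E_twins_lt vu _ nv' nu'.
    by move=> t; apply: nR; right; right.
  exists (`]a, +oo[%classic, `]-oo, b[%classic).
    split; apply: open_nbhs_nbhs; split.
    - exact: (@rray_open _ (gapcomp X3)).
    - by rewrite /= in_itv /= ?andbT.
    - exact: (@lray_open _ (gapcomp X3)).
    - by rewrite /= in_itv /= ?andbT.
  move=> u' v'; rewrite /= !in_itv /= andbT => au' v'b.
  have [lt nt] := h _ _ v'b au'; move=> [/= E|[/twins_lt|//]].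
    by move: lt; rewrite E ltxx.
  by move=> /(lt_trans lt); rewrite ltxx.
- by case: nR; left.
Qed.

Let ends_closed : closed [set p : bm * bm | p.1 = p.2 \/ E_ends p.1 p.2].
Proof.
have hb := @gspace_hausdorff _ bm.
have c1 (z : bm) : closed [set z].
  exact/accessible_closed_set1/hausdorff_accessible.
have c2 : closed [set z : bm | z = binf \/ z = bsup].
  by apply: (@closedU _ [set binf] [set bsup]); exact: c1.
apply: closedU; first exact: diag_closed.
apply: closedI.
- by apply: (@preimage_closed _ _ fst _ _ c2) => p _; exact: cvg_fst.
- by apply: (@preimage_closed _ _ snd _ _ c2) => p _; exact: cvg_snd.
Qed.

Let genE (r E : bm -> bm -> Prop) :
  (forall u v, r u v -> E u v) ->
  (forall u, E u u) -> (forall u v, E u v -> E v u) ->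
  (forall u v w, E u v -> E v w -> E u w) ->
  (forall u v, E u v -> clos_refl_sym_trans bm r u v) ->
  [set p : bm * bm | clos_refl_sym_trans bm r p.1 p.2] =
  [set p | E p.1 p.2].
Proof.
move=> rE Er Es Et Ec; apply/seteqP; split=> -[u v] /=; last exact: Ec.
elim=> [a b /rE//|a|a b _ /Es//|a b c _ ab _]; [exact: Er | exact: Et ab].
Qed.

Lemma r_ends_closed :
  closed [set p : bm * bm | clos_refl_sym_trans bm r_ends p.1 p.2].
Proof.
rewrite (genE (E := fun u v => u = v \/ E_ends u v)); first exact: ends_closed.
- by move=> u v [-> ->]; right; split; [left|right].
- by left.
- by move=> u v [->|[? ?]]; [left|right].
- by move=> u v w [->//|[? ?]] [<-|[? ?]]; right.
- move=> u v [->|[]]; first exact: rst_refl.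
  have st : clos_refl_sym_trans bm r_ends binf bsup by exact: rst_step.
  by move=> [->|->] [->|->]; [exact: rst_refl|..|exact: rst_refl] => //;
    exact: rst_sym.
Qed.

Let E_twins_trans u v w : u = v \/ E_twins u v -> v = w \/ E_twins v w ->
  u = w \/ E_twins u w.
Proof.
move=> [->//|uv] [<-|vw]; first by right.
left; case: uv vw => [[x [-> ->]]|[x [-> ->]]] [[y []]|[y []]].
- by move=> e; case: (@bpt_neq _ _ spos sneg isT e).
- by move=> -> /bpt_inj ->.
- by move=> /bpt_inj -> ->.
- by move=> _ e; case: (@bpt_neq _ _ sneg spos isT e).
Qed.

Lemma r_twins_closed :
  closed [set p : bm * bm | clos_refl_sym_trans bm r_twins p.1 p.2].
Proof.
rewrite (genE (E := fun u v => u = v \/ E_twins u v)); first exact: twins_closed.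
- by move=> u v ?; right; left.
- by left.
- by move=> u v [->|[?|?]]; [left|right; right|right; left].
- exact: E_twins_trans.
- move=> u v [->|[?|?]]; [exact: rst_refl|exact: rst_step|].
  exact/rst_sym/rst_step.
Qed.

Lemma r_both_closed :
  closed [set p : bm * bm | clos_refl_sym_trans bm r_both p.1 p.2].
Proof.
have notE u v : E_ends u u -> E_twins u v -> False.
  by move=> [h _] [[x [uE _]]|[x [_ uE]]]; case: h; rewrite uE.
have E_sym u v : E_twins u v -> E_twins v u by case; [right|left].
rewrite (genE (E := fun u v => (u = v \/ E_ends u v) \/ (u = v \/ E_twins u v))).
- exact: closedU ends_closed twins_closed.
- by move=> u v [[-> ->]|?]; [left; right; split; [left|right]|right;right;left].
- by left; left.
- by move=> u v [[->|[? ?]]|[->|/E_sym]];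
    [left;left|left;right|left;left|right;right].
- move=> u v w [[->//|uv]|[->//|uv]] [[<-|vw]|[<-|vw]].
  + by left; right.
  + by left; right; split; [case: uv|case: vw].
  + by left; right.
  + by exfalso; apply: (@notE v w) => //; case: uv.
  + by right; right.
  + by exfalso; apply: (@notE v u); [case: vw|exact: E_sym].
  + by right; right.
  + by right; apply: E_twins_trans; right; eassumption.
- have st : clos_refl_sym_trans bm r_both binf bsup by apply: rst_step; left.
  move=> u v [[->|[]]|[->|[t|t]]]; try exact: rst_refl.
  + by move=> [->|->] [->|->]; [exact: rst_refl|..|exact: rst_refl] => //;
      exact: rst_sym.
  + by apply: rst_step; right.
  + by apply/rst_sym/rst_step; right.
Qed.

(* b with a left-right arrow, an up-down arrow, and a plus. *)
Definition b_lr : gspace (Aut X) :=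
  quot_gspace r_ends_inv bm_compact r_ends_closed.
Definition b_ud : gspace (Aut X) :=
  quot_gspace r_twins_inv bm_compact r_twins_closed.
Definition b_plus : gspace (Aut X) :=
  quot_gspace r_both_inv bm_compact r_both_closed.

Definition ud_inf : b_ud := qpi r_twins binf.
Definition ud_sup : b_ud := qpi r_twins bsup.

Lemma b_ud_act_inj g : injective (gact g : b_ud -> b_ud).
Proof.
have [h ah [gh hg]] := automorphism_inv (autP g).
pose k : Aut X := SigSub (mem_set ah).
have K3 (p : X3) : aut3 k (aut3 g p) = p.
  case: p => x s; change ((h (g x), s) = (x, s) :> X3); by rewrite gh.
have K (u : bm) : gact k (gact g u) = u.
  case: u => [p|A]; first by congr inl; exact: K3.
  congr inr; apply: low_inj; apply/seteqP; split=> [_ [_ [p Ap <-] <-]|p Ap].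
    by rewrite K3.
  exists (aut3 g p); last exact: K3.
  by exists p.
apply: (can_inj (g := gact k)) => a; have [u <-] := qpi_surj a.
have qE := quot_actE r_twins_inv.
by rewrite [gact g _]qE [LHS]qE K.
Qed.

Lemma b_ud_act_inf g : gact g ud_inf = ud_inf.
Proof. by rewrite [LHS](quot_actE r_twins_inv) bm_act_inf. Qed.

Lemma b_ud_act_sup g : gact g ud_sup = ud_sup.
Proof. by rewrite [LHS](quot_actE r_twins_inv) bm_act_sup. Qed.

Fact fixed_setC (T : gspace (Aut X)) (z : T) :
  (forall g, injective (gact g : T -> T)) -> (forall g, gact g z = z) ->
  forall g x, [set~ z] x -> [set~ z] (gact g x).
Proof. by move=> gi gz g x xz gxz; apply: xz; apply: (gi g); rewrite gz. Qed.

Fact fixed_setCI (T : gspace (Aut X)) (z w : T) :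
  (forall g, injective (gact g : T -> T)) ->
  (forall g, gact g z = z) -> (forall g, gact g w = w) ->
  forall g x, ([set~ z] `&` [set~ w]) x -> ([set~ z] `&` [set~ w]) (gact g x).
Proof. by move=> gi gz gw g x [xz xw]; split; exact: fixed_setC. Qed.

Definition Yminus : gspace (Aut X) :=
  sub_gspace (fixed_setC bm_act_inj bm_act_sup).
Definition Yplus : gspace (Aut X) :=
  sub_gspace (fixed_setC bm_act_inj bm_act_inf).
Definition Yboth : gspace (Aut X) :=
  sub_gspace (fixed_setCI bm_act_inj bm_act_inf bm_act_sup).
Definition Zminus : gspace (Aut X) :=
  sub_gspace (fixed_setC b_ud_act_inj b_ud_act_sup).
Definition Zplus : gspace (Aut X) :=
  sub_gspace (fixed_setC b_ud_act_inj b_ud_act_inf).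
Definition Zboth : gspace (Aut X) :=
  sub_gspace (fixed_setCI b_ud_act_inj b_ud_act_inf b_ud_act_sup).

Fact discrete_act_continuous (g : Aut X) :
  continuous (g : discrete_topology X -> discrete_topology X).
Proof. by apply/continuousP => A _; exact: discrete_open. Qed.

Definition Xdiscrete : gspace (Aut X) :=
  GSpace discrete_act_continuous
    (@discrete_hausdorff (discrete_topology X)).

Local Notation alphaX := (one_point_compactification (discrete_topology X)).

Definition alpha_act (g : Aut X) : alphaX -> alphaX := omap g.

Fact alpha_act_continuous (g : Aut X) : continuous (alpha_act g).
Proof.
have [h ah [gh hg]] := automorphism_inv (autP g).
move=> [x|] U.
  move=> /nbhs_singleton Ugx.
  have := @one_point_compactification_some_nbhs (discrete_topology X) x _
    (discrete_set1 (x : discrete_topology X)).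
  by apply: (@filterS _ (nbhs (Some x : alphaX)) _) => _ [y -> <-].
move=> [C [cC _] CU].
exists (h @` C).
  split; last exact: discrete_closed.
  apply: continuous_compact cC; apply: continuous_subspaceT.
  by apply/continuousP => A _; exact: discrete_open.
move=> [x|] [] //=.
- move=> [y nCy [<-]]; apply: CU; left; exists (g y) => // Cgy.
  by apply: nCy; exists (g y).
- by move=> _; apply: CU; right.
- by move=> _; apply: CU; right.
Qed.

Fact alpha_hausdorff : hausdorff_space alphaX.
Proof.
have o1 (x : discrete_topology X) : open [set Some x : alphaX].
  rewrite -(image_set1 Some); apply: one_point_compactification_open_some.
  exact: discrete_open.
have o2 (x : discrete_topology X) : open (~` [set Some x : alphaX]).
  rewrite openE => -[y|] /= yx; rewrite /interior.
    have := open_nbhs_nbhs (conj (o1 y) erefl).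
    by apply: (@filterS _ (nbhs (Some y : alphaX)) _) => _ ->.
  exists [set x]; first by split; [exact: compact_set1 | exact: discrete_closed].
  by move=> _ [[y nyx <-] [xy]|->]; first exact: nyx.
have sep (x : discrete_topology X) (b : alphaX) : Some x != b ->
    exists2 AB : set alphaX * set alphaX, (Some x \in AB.1 /\ b \in AB.2) &
                [/\ open AB.1, open AB.2 & AB.1 `&` AB.2 == set0].
  move=> xb; exists ([set Some x : alphaX], ~` [set Some x : alphaX]) => /=.
    by split; apply/mem_set => // bx; rewrite bx eqxx in xb.
  by split=> //; rewrite setICr.
rewrite open_hausdorff => -[x|] [y|] // ab; try exact: sep.
have [|[U V] [/= Uy Vn] [oU oV UV]] := sep y None; first by [].
by exists (V, U); split; rewrite //= setIC.
Qed.

Definition alpha : gspace (Aut X) :=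
  GSpace alpha_act_continuous alpha_hausdorff.

End Chain.

Section Compactifications.
Context (G : topologicalType).

Definition is_compactification (c : extension G) : Prop :=
  [/\ compact [set: c], hausdorff_space c, dense (range (@ext_emb G c)),
      injective (@ext_emb G c) &
      forall U : set G,
        open U <-> exists2 V : set c, open V & @ext_emb G c @^-1` V = U].

(* The maps of compactifications are those between spaces that are indeed
   compactifications of the topological group G. *)
Definition comp_map (c c' : extension G) (f : c -> c') : Prop :=
  [/\ is_compactification c, is_compactification c', continuous f &
      forall g, f (ext_emb c g) = ext_emb c' g].

Definition comp_eq (c c' : extension G) : Prop :=
  exists (f : c -> c') (h : c' -> c),
    [/\ comp_map f, continuous h, cancel f h & cancel h f].

Definition collapse (c : extension G) (S : set c) : extension G :=
  @Extension G (quot (fun x y : c => S x /\ S y))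
    (fun g => qpi _ (ext_emb c g)).

End Compactifications.

Definition elementary (S T : topologicalType) (f : S -> T) : Prop :=
  [/\ range f = [set: T],
      forall V : set T, open V <-> open (f @^-1` V) &
      exists t0, forall t, t <> t0 -> exists s, f @^-1` [set t] = [set s]].

Section ZeroK.
Context d (X : orderType d).

Definition A_inf : set (bm X * bm X) :=
  (setT `*` [set binf X]) `|` ([set bsup X] `*` setT).
Definition A_sup : set (bm X * bm X) :=
  ([set binf X] `*` setT) `|` (setT `*` [set bsup X]).

Definition zeroK : set (graph_comp (bm X)) :=
  [set F : graph_space (bm X) |
    hset (set_val F) = A_inf \/ hset (set_val F) = A_sup].

End ZeroK.

Arguments A_inf {d} X _.
Arguments A_sup {d} X _.
Arguments zeroK {d} X _.

Arguments A_inf {d} X _.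
Arguments A_sup {d} X _.
Arguments zeroK {d} X _.

(* Main.v *)
(* A point of the graph compactification b_T G is a Fell limit F of graphs. Let
   T be a compact G-space containing X as a set of isolated points x; then F has
   exactly one point on each vertical line {x} x T and, inverting the
   automorphisms, on each horizontal line T x {x}. If T also has a fixed point e
   such that the points of F on {e} x T other than (e, e) are limits of points of
   F on those lines (the "hairs"), then F is determined by its trace on the
   square of U = T \ {e}: a hair that leaves U^2 has to end at e. So the
   restriction b_T G -> b_U G is injective, hence a homeomorphism. The condition
   on e holds at both ends of b_m X and passes to its quotients, which gives (b)
   to (f), as b<->X, b+X and alpha X are one-point compactifications of Y, Z, X.

   For (a), a limit graph on b_m X that meets Y^2 is monotone, so its values at
   the ends are forced by its trace on Y^2; one that misses Y^2 takes the value
   inf at all x, or the value sup at some x, and is then A_inf or A_sup. *)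

Require Import Defs.
From Stdlib Require Import Relation_Operators.
From mathcomp Require Import all_boot all_order interval finmap all_classical topology.

Set Implicit Arguments.
Unset Strict Implicit.
Unset Printing Implicit Defensive.

Import Order.TTheory.

Local Open Scope classical_set_scope.

(** * The Fell topology *)

(** The recurrent tool is transfer to actual automorphisms: hitting an open set and missing a
    compact set are open conditions, so finitely many of them satisfied by a limit graph hold for
    the graph of some g, where bijectivity and monotonicity apply. This dictates the test sets: open
    rectangles for hits, compact rectangles for misses, and lines over isolated points, which are
    both open and compact when the space is compact.

    Equality of compactifications also demands that G embeds topologically. Isolated points recover
    the permutation topology; continuity of the embedding is proved by order arguments on b_m X, and
    is inherited by quotients and by open invariant subspaces because images and restrictions act
    continuously on the hyperspaces.

    Ultrahomogeneity enters through one and two points: it makes X a dense order without end points,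
    hence topologically dense in b_m X, and it moves any x below any y, which produces graphs
    accumulating at A_inf. *)

Lemma compact_inj_homeo (S T : topologicalType) (f : S -> T) :
  compact [set: S] -> hausdorff_space T -> continuous f ->
  injective f -> range f = [set: T] ->
  exists2 h : T -> S, continuous h & cancel f h /\ cancel h f.
Proof.
move=> cS hT cf fi fs; have [h fh hf] : bijective f.
  by rewrite -setTT_bijective; split=> //; [exact: in2W|rewrite /set_surj fs].
exists h => //.
apply/continuous_closedP => A cA.
rewrite (_ : h @^-1` A = f @` A); last first.
  apply/seteqP; split=> [x Ax|_ [y Ay <-]]; first by exists (h x).
  by rewrite /preimage/= fh.
apply: compact_closed => //; apply: continuous_compact.
  exact: continuous_subspaceT.
exact: subclosed_compact cS _.
Qed.

(** The first hypothesis says that neighbourhoods in [S] are no finer than those pulled back along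
    [f], so a cluster point of the pushed-forward filter lifts to a cluster point of the filter
    itself. Subspaces and open embeddings are both of this kind. *)
Lemma compact_preimage_inj (S T : topologicalType) (f : S -> T) (C : set T) :
  (forall x U, nbhs x U -> exists2 V, nbhs (f x) V & f @^-1` V `<=` U) ->
  C `<=` range f -> compact C -> compact (f @^-1` C).
Proof.
move=> fnbhs Cf cC F FF FC.
have [y [Cy Fy]] : C `&` cluster (f @ F) !=set0 by apply: cC.
have [x _ xy] := Cf _ Cy; rewrite -{}xy in Cy Fy.
exists x; split=> // A U FA /fnbhs[V Vx VU].
have [|_ [[z Az <-] Vz]] := Fy (f @` A) V _ Vx.
  by apply: (@filterS _ F _ A) => // w Aw; exists w.
by exists z; split=> //; exact: VU.
Qed.

Lemma initial_nbhs (T : topologicalType) (A : set T) (x : set_type A) U :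
  nbhs x U -> exists2 V, nbhs (set_val x) V & set_val @^-1` V `<=` U.
Proof.
by move=> [_ [[W oW <-] Wx WU]]; exists W => //; exact: open_nbhs_nbhs.
Qed.

Lemma compact_set_type (T : topologicalType) (A : set T) :
  compact A -> compact [set: set_type A].
Proof.
move=> cA; rewrite (_ : setT = set_val @^-1` A).
  apply: compact_preimage_inj cA; first exact: initial_nbhs.
  by move=> x Ax; exists (SigSub (mem_set Ax)).
by apply/seteqP; split=> // x _; exact: set_valP.
Qed.

Section Hyperspace.
Context (E : topologicalType).
Implicit Types F : hyperspace E.

Lemma hset_inj : injective (@hset E).
Proof. by move=> F F' FF'; exact: val_inj. Qed.

Lemma hset_closed F : closed (hset F).
Proof. exact: set_valP F. Qed.

Lemma fell_subbase_open (A : set (hyperspace E)) : fell_subbase E A -> open A.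
Proof.
move=> bA; exists [set A]; last by rewrite bigcup_set1.
move=> B ->; exists [fset A]%fset; last by rewrite set_fset1 bigcap_set1.
by move=> C; rewrite in_fset1 => /eqP ->; exact/mem_set.
Qed.

Lemma open_hit (W : set E) : open W -> open [set F | hset F `&` W !=set0].
Proof. by move=> oW; apply: fell_subbase_open; left; exists W. Qed.

Lemma open_miss (C : set E) : compact C -> open [set F | hset F `&` C = set0].
Proof. by move=> cC; apply: fell_subbase_open; right; exists C. Qed.

Lemma nbhs_hit (W : set E) F : open W -> hset F `&` W !=set0 ->
  \forall F' \near F, hset F' `&` W !=set0.
Proof. by move=> oW FW; apply: open_nbhs_nbhs; split=> //; exact: open_hit. Qed.

Lemma nbhs_miss (C : set E) F : compact C -> hset F `&` C = set0 ->
  \forall F' \near F, hset F' `&` C = set0.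
Proof. by move=> cC FC; apply: open_nbhs_nbhs; split=> //; exact: open_miss. Qed.

Lemma fell_cvg (Phi : set_system (hyperspace E)) F : Filter Phi ->
  (forall W, open W -> hset F `&` W !=set0 ->
     Phi [set F' | hset F' `&` W !=set0]) ->
  (forall C, compact C -> hset F `&` C = set0 ->
     Phi [set F' | hset F' `&` C = set0]) ->
  Phi --> F.
Proof.
move=> FPhi hit miss N; rewrite /= nbhsE => -[A [[D' D'f <-] [B D'B BF]] DN].
apply: filterS DN _; apply: (@filterS _ Phi _ B); first by move=> ? ?; exists B.
have [S Sb SB] := D'f _ D'B; rewrite -{}SB in BF *.
apply: filter_bigI => A' A'S.
have /set_mem[[W oW WE]|[C cC CE]] := Sb _ A'S.
  by have := BF _ A'S; rewrite /= WE; exact: hit.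
by have := BF _ A'S; rewrite /= CE; exact: miss.
Qed.

Lemma fell_continuous (S : topologicalType) (f : S -> hyperspace E) :
  (forall W, open W -> open (f @^-1` [set F | hset F `&` W !=set0])) ->
  (forall C, compact C -> open (f @^-1` [set F | hset F `&` C = set0])) ->
  continuous f.
Proof.
move=> hit miss x; apply: fell_cvg => [W oW Wx|C cC Cx].
  by apply: open_nbhs_nbhs; split; [exact: (hit W)|].
by apply: open_nbhs_nbhs; split; [exact: (miss C)|].
Qed.

(** An ultrafilter converges to the set [F0] of all points each of whose open neighbourhoods is hit
    by Phi-almost all closed sets. *)
Lemma hyperspace_compact : compact [set: hyperspace E].
Proof.
rewrite compact_ultra => Phi PhiU _.
pose F0 := [set e | forall W, open W -> W e -> Phi [set F | hset F `&` W !=set0]].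
have F0c : closed F0.
  move=> e ce W oW We; have [e' [F0e' We']] := ce W (open_nbhs_nbhs (conj oW We)).
  exact: F0e'.
exists (SigSub (mem_set F0c)); split=> //; apply: fell_cvg.
  by move=> W oW [e [F0e We]]; exact: F0e.
move=> C cC F0C.
(* The near-covering form of compactness stands in for a finite subcover: near each point of C all
   members of a small enough set of Phi avoid the points, hence one such set works on all of C. *)
have /compact_near_coveringP /(_ _ (powerset_filter_from Phi)) := cC.
move=> /(_ (fun A e => forall F, A F -> ~ hset F e) _)[].
  move=> e Ce; have nF0e : ~ F0 e by move=> F0e; have : set0 e by rewrite -F0C.
  have [W [oW We nW]] : exists W, [/\ open W, W e &
      ~ Phi [set F | hset F `&` W !=set0]].
    apply: contrapT => h; apply: nF0e => W oW We; apply: contrapT => nP.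
    by apply: h; exists W.
  have [//|PW] := in_ultra_setVsetC [set F | hset F `&` W !=set0] PhiU.
  exists (W, [set A | A `<=` ~` [set F | hset F `&` W !=set0]]).
    split; first exact: open_nbhs_nbhs.
    exact: small_set_sub.
  by move=> [e' A] [/= We' AW] F AF Fe'; apply: (AW _ AF); exists e'.
move=> G [GPhi _ [A GA]] h; apply: filterS (GPhi _ GA) => F AF.
by apply/seteqP; split=> // e [Fe Ce]; exact: h GA _ Ce _ AF Fe.
Qed.

Definition lc_space := forall (e : E) N, nbhs e N ->
  exists2 C, compact C & nbhs e C /\ C `<=` N.

(** A point of F outside F' has a compact neighbourhood C disjoint from F'; hitting the interior of
    C and missing C are incompatible open conditions that hold at F and at F'. *)
Lemma hyperspace_hausdorff : lc_space -> hausdorff_space (hyperspace E).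
Proof.
move=> lc F F' FF'; apply: hset_inj.
wlog suff h : F F' FF' / hset F `<=` hset F'.
  apply/seteqP; split; apply: h => //.
  by move=> A B FA FB; have [x [Bx Ax]] := FF' _ _ FB FA; exists x.
move=> e Fe; apply: contrapT => nF'e.
have [C cC [eC CF']] : exists2 C, compact C & nbhs e C /\ C `<=` ~` hset F'.
  apply: lc; apply: open_nbhs_nbhs; split=> //.
  exact/closed_openC/hset_closed.
have miss : hset F' `&` C = set0 by apply/seteqP; split=> // x [F'x /CF'].
have hit : hset F `&` C^° !=set0 by exists e.
have [G [[u [Gu Cu]] GC]] :=
  FF' _ _ (nbhs_hit (@open_interior _ C) hit) (nbhs_miss cC miss).
by have : set0 u by rewrite -GC; split=> //; exact: interior_subset.
Qed.

End Hyperspace.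

(** * Maps of hyperspaces and of compactifications *)

Lemma compact_lc_space (E : topologicalType) :
  compact [set: E] -> hausdorff_space E -> lc_space E.
Proof.
move=> cE hE e N eN; have [C eC CN] := compact_regular hE cE filterT eN.
exists (closure C); first exact: (subclosed_compact (@closed_closure _ _) cE).
by split=> //; apply: filterS eC; exact: subset_closure.
Qed.

Lemma lc_space_prod (E E' : topologicalType) :
  lc_space E -> lc_space E' -> lc_space (E * E')%type.
Proof.
move=> lE lE' [e e'] N [[A B] [/= eA eB] AN].
have [C cC [eC CA]] := lE e A eA; have [C' cC' [eC' CB]] := lE' e' B eB.
exists (C `*` C'); first exact: compact_setX.
split; first by exists (C, C').
by move=> [x y] [/= Cx C'y]; apply: AN; split; [exact: CA|exact: CB].
Qed.

Lemma open_prod (S T : topologicalType) (A : set S) (B : set T) :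
  open A -> open B -> open (A `*` B).
Proof.
move=> oA oB; rewrite openE => -[a b] [/= Aa Bb].
by exists (A, B) => //; split; exact: open_nbhs_nbhs.
Qed.

Lemma hausdorff_prod (S T : topologicalType) :
  hausdorff_space S -> hausdorff_space T -> hausdorff_space (S * T)%type.
Proof.
move=> hS hT [a b] [a' b'] ab; congr (_, _).
- apply: hS => A A' aA aA'.
  have [||[z w] [[Az _] [A'z _]]] := ab (A `*` setT) (A' `*` setT); last by exists z.
  + by exists (A, setT) => //; split => //=; try exact: filterT.
  + by exists (A', setT) => //; split => //=; try exact: filterT.
- apply: hT => B B' bB bB'.
  have [||[z w] [[_ Bw] [_ B'w]]] := ab (setT `*` B) (setT `*` B');
    last by exists w.
  + by exists (setT, B) => //; split => //=; try exact: filterT.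
  + by exists (setT, B') => //; split => //=; try exact: filterT.
Qed.

Definition open_embedding (S T : topologicalType) (f : S -> T) :=
  [/\ continuous f, injective f & forall U, open U -> open (f @` U)].

Lemma open_embedding_nbhs (S T : topologicalType) (f : S -> T) x U :
  open_embedding f -> nbhs x U -> nbhs (f x) (f @` U).
Proof.
move=> [_ _ fo]; rewrite nbhsE => -[V [oV Vx] VU].
apply: (@filterS _ _ _ (f @` V)); first exact: image_subset.
by apply: open_nbhs_nbhs; split; [exact: fo|exists x].
Qed.

Lemma lc_space_open_embedding (S T : topologicalType) (f : S -> T) :
  open_embedding f -> lc_space T -> lc_space S.
Proof.
move=> fe lT x N xN; have [fc fi fo] := fe.
have [C cC [xC CN]] := lT _ _ (open_embedding_nbhs fe xN).
exists (f @^-1` C).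
  apply: compact_preimage_inj cC.
    move=> y U yU; exists (f @` U); first exact: open_embedding_nbhs.
    by move=> z [w Uw /fi <-].
  by move=> y /CN[z _ <-]; exists z.
by split; [exact: fc|move=> y /CN[z Nz /fi <-]].
Qed.

Definition sqmap (S T : Type) (f : S -> T) (p : S * S) : T * T := (f p.1, f p.2).

Lemma sqmap_continuous (S T : topologicalType) (f : S -> T) :
  continuous f -> continuous (sqmap f).
Proof.
move=> cf p; apply: cvg_pair.
- by apply: (@continuous_comp _ _ _ fst f); [exact: cvg_fst|exact: cf].
- by apply: (@continuous_comp _ _ _ snd f); [exact: cvg_snd|exact: cf].
Qed.

Lemma open_embedding_sqmap (S T : topologicalType) (f : S -> T) :
  open_embedding f -> open_embedding (sqmap f).
Proof.
move=> fe; have [cf fi fo] := fe; split; first exact: sqmap_continuous.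
  by move=> [a b] [a' b'] [/fi -> /fi ->].
move=> U oU; rewrite openE => _ [[a b] Uab <-].
have [[A B] [/= aA bB] ABU] := open_nbhs_nbhs (conj oU Uab).
exists (f @` A, f @` B); first by split=> /=; apply: (open_embedding_nbhs fe).
move=> [u v] [/= [x Ax <-] [y By <-]].
by exists (x, y) => //; apply: ABU.
Qed.

(** * Direct and inverse images as continuous maps of hyperspaces *)

Section HyperspaceMaps.
Context (E E' : topologicalType).

Section Image.
Context (f : E -> E').
Hypotheses (cE : compact [set: E]) (hE' : hausdorff_space E')
  (cf : continuous f).

Fact himage_closed (F : hyperspace E) : closed (f @` hset F).
Proof.
apply: compact_closed => //; apply: continuous_compact.
  exact: continuous_subspaceT.
apply: (subclosed_compact _ cE) => //; exact: hset_closed.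
Qed.

Definition himage (F : hyperspace E) : hyperspace E' :=
  SigSub (mem_set (@himage_closed F)).

(** f(F) meets a set exactly when F meets its preimage, and preimages of compact sets are compact
    because [E] is compact. *)
Lemma himage_continuous : continuous himage.
Proof.
have hit F W : (hset (himage F) `&` W !=set0) = (hset F `&` f @^-1` W !=set0).
  apply/propext; split=> [[_ [[x Fx <-] Wx]]|[x [Fx Wx]]]; first by exists x.
  by exists (f x); split=> //; exists x.
apply: fell_continuous => [W oW|C cC].
  rewrite (_ : _ @^-1` _ = [set F | hset F `&` f @^-1` W !=set0]).
    by apply: open_hit; apply: open_comp => // x _; exact: cf.
  by apply/seteqP; split=> F; rewrite /preimage /= hit.
rewrite (_ : _ @^-1` _ = [set F | hset F `&` f @^-1` C = set0]).
  apply: open_miss; apply: (subclosed_compact _ cE) => //.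
  by apply: preimage_closed; [move=> x _; exact: cf|exact: compact_closed].
apply/seteqP; split=> F /= h; apply: contrapT => /eqP/set0P.
  by rewrite -hit => /set0P/eqP.
by rewrite hit => /set0P/eqP.
Qed.

End Image.

Section Preimage.
Context (f : E -> E').
Hypothesis fe : open_embedding f.

Fact hpreimage_closed (F : hyperspace E') : closed (f @^-1` hset F).
Proof.
have [cf _ _] := fe.
by apply: preimage_closed; [move=> x _; exact: cf|exact: hset_closed].
Qed.

Definition hpreimage (F : hyperspace E') : hyperspace E :=
  SigSub (mem_set (@hpreimage_closed F)).

(** The preimage of F meets W exactly when F meets f(W). Openness of f keeps f(W) open, and
    continuity keeps f(C) compact, so both kinds of subbasic sets pull back to subbasic sets. *)
Lemma hpreimage_continuous : continuous hpreimage.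
Proof.
have [cf fi fo] := fe.
have hit F W : (hset (hpreimage F) `&` W !=set0) = (hset F `&` f @` W !=set0).
  apply/propext; split=> [[x [Fx Wx]]|[y [Fy [x Wx xy]]]].
    by exists (f x); split=> //; exists x.
  by exists x; split=> //; move: Fy; rewrite -xy.
apply: fell_continuous => [W oW|C cC].
  rewrite (_ : _ @^-1` _ = [set F | hset F `&` f @` W !=set0]).
    by apply: open_hit; exact: fo.
  by apply/seteqP; split=> F; rewrite /preimage /= hit.
rewrite (_ : _ @^-1` _ = [set F | hset F `&` f @` C = set0]).
  by apply: open_miss; apply: continuous_compact cC; exact: continuous_subspaceT.
apply/seteqP; split=> F /= h; apply: contrapT => /eqP/set0P.
  by rewrite -hit => /set0P/eqP.
by rewrite hit => /set0P/eqP.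
Qed.

End Preimage.

End HyperspaceMaps.

Section Extensions.
Context (G : topologicalType).
Implicit Types c : extension G.

Lemma extension_map_surj c c' (f : c -> c') :
  compact [set: c] -> hausdorff_space c' -> dense (range (@ext_emb G c')) ->
  continuous f -> (forall g, f (ext_emb c g) = ext_emb c' g) ->
  range f = [set: c'].
Proof.
move=> cc hc' dc' cf fE.
have cl : closed (range f).
  apply: compact_closed => //; apply: continuous_compact => //.
  exact: continuous_subspaceT.
apply/seteqP; split=> // y _; apply: contrapT => ny.
have [|z [nz [g _ gz]]] := dc' (~` range f) _ (closed_openC cl).
  by exists y.
by apply: nz; exists (ext_emb c g); rewrite // fE.
Qed.

Lemma comp_map_surj c c' (f : c -> c') : comp_map f -> range f = [set: c'].
Proof.
by move=> [[cc _ _ _ _] [_ hc' dc' _ _] cf fE]; exact: extension_map_surj.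
Qed.

Lemma comp_map_inj_eq c c' (f : c -> c') :
  comp_map f -> injective f -> comp_eq c c'.
Proof.
move=> fm fi; have [[cc hc _ _ _] [_ hc' _ _ _] cf _] := fm.
have [h ch [fh hf]] := compact_inj_homeo cc hc' cf fi (comp_map_surj fm).
by exists f, h.
Qed.

Lemma comp_eq_sym c c' : comp_eq c c' -> comp_eq c' c.
Proof.
move=> [f [h [[Kc Kc' cf fE] ch fh hf]]]; exists h, f; split=> //.
by split=> // g; rewrite -fE fh.
Qed.

Lemma comp_eq_trans c1 c2 c3 : comp_eq c1 c2 -> comp_eq c2 c3 -> comp_eq c1 c3.
Proof.
move=> [f [h [[K1 K2 cf fE] ch fh hf]]] [f' [h' [[_ K3 cf' fE'] ch' fh' hf']]].
exists (f' \o f), (h \o h'); split.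
- split=> //; last by move=> g; rewrite /= fE fE'.
  by move=> x; apply: continuous_comp; [exact: cf|exact: cf'].
- by move=> x; apply: continuous_comp; [exact: ch'|exact: ch].
- exact: can_comp.
- exact: can_comp.
Qed.

(** Of [c] only compactness is asked: the other properties of a compactification are carried back
    along [f]. This serves the collapse of 0_K, where a direct check of the Hausdorff property is
    avoided. *)
Lemma comp_eq_inj c c' (f : c -> c') :
  compact [set: c] -> is_compactification c' -> continuous f -> injective f ->
  (forall g, f (ext_emb c g) = ext_emb c' g) -> comp_eq c c'.
Proof.
move=> cc Kc' cf fi fE; have [cc' hc' dc' ic' oc'] := Kc'.
have fs := extension_map_surj cc hc' dc' cf fE.
have [h ch [fh hf]] := compact_inj_homeo cc hc' cf fi fs.
apply: (@comp_map_inj_eq _ _ f) => //; split=> //; split=> //.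
- move=> x y xy; apply: fi; apply: hc' => A B fA fB.
  by have [z [? ?]] := xy _ _ (cf _ _ fA) (cf _ _ fB); exists (f z).
- move=> U [x Ux] oU.
  have [||y [Uy [g _ gy]]] := dc' (h @^-1` U).
  + by exists (f x); rewrite /preimage /= fh.
  + by apply: open_comp => // y _; exact: ch.
  exists (ext_emb c g); split; last by exists g.
  by move: Uy; rewrite -gy /preimage /= -fE fh.
- by move=> g g' gg'; apply: ic'; rewrite -!fE gg'.
- move=> U; rewrite oc'; split=> -[V oV <-].
    exists (f @^-1` V); first by apply: open_comp => // y _; exact: cf.
    by apply/seteqP; split=> g; rewrite /preimage /= fE.
  exists (h @^-1` V); first by apply: open_comp => // y _; exact: ch.
  by apply/seteqP; split=> g; rewrite /preimage /= -fE fh.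
Qed.

End Extensions.

Section GraphComp.
Context (G : topologicalType).
Implicit Types T : gspace G.

Lemma graph_comp_compact T : compact [set: graph_comp T].
Proof.
apply: compact_set_type; apply: (subclosed_compact _ (@hyperspace_compact _)) => //.
exact: closed_closure.
Qed.

Lemma graph_comp_hausdorff T : lc_space T -> hausdorff_space (graph_comp T).
Proof.
move=> lT x y xy; apply: val_inj.
apply: (hyperspace_hausdorff (lc_space_prod lT lT)) => A B xA yB.
have cv := @initial_continuous _ (hyperspace (T * T)%type)
  (set_val : set_type (closure (range (@graph_emb G T))) -> _).
by have [z [? ?]] := xy _ _ (cv x _ xA) (cv y _ yB); exists (set_val z).
Qed.

Lemma graph_comp_dense T : dense (range (@ext_emb G (graph_comp T))).
Proof.
move=> U [x Ux] [W oW WU]; rewrite -WU in Ux *.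
have [_ [[g _ <-] Wg]] := set_valP x _ (open_nbhs_nbhs (conj oW Ux)).
by exists (ext_emb (graph_comp T) g); split=> //; exists g.
Qed.

Lemma graph_comp_emb_continuous T :
  continuous (@graph_emb G T) -> continuous (@ext_emb G (graph_comp T)).
Proof.
by move=> ce; apply: continuous_comp_initial => g; exact: ce.
Qed.

Section Map.
Context (K T : gspace G) (f : hyperspace (K * K)%type -> hyperspace (T * T)%type).
Hypotheses (cf : continuous f)
  (fgraph : forall g, f (graph_emb K g) = graph_emb T g).

Fact graph_comp_map_closure F :
  closure (range (@graph_emb G K)) F -> closure (range (@graph_emb G T)) (f F).
Proof.
move=> cF N /cf/cF[_ [[g _ <-] Ng]]; exists (graph_emb T g); split.
  by exists g.
by rewrite -fgraph.
Qed.

Definition graph_comp_map (F : graph_comp K) : graph_comp T :=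
  SigSub (mem_set (graph_comp_map_closure (set_valP F))).

Lemma graph_comp_map_continuous : continuous graph_comp_map.
Proof.
apply: continuous_comp_initial => F.
by apply: (@continuous_comp _ _ _ set_val f);
  [exact: initial_continuous|exact: cf].
Qed.

Lemma graph_comp_map_emb g :
  graph_comp_map (ext_emb (graph_comp K) g) = ext_emb (graph_comp T) g.
Proof. by apply: val_inj; exact: fgraph. Qed.

End Map.

End GraphComp.

(** * Graph compactifications of Aut X *)

Section AutTopology.
Context d (X : orderType d).
Implicit Types g h : Aut X.

Lemma aut_near g x : nbhs g [set h : Aut X | h x = g x].
Proof.
have cv : continuous (set_val : Aut X -> _) by exact: initial_continuous.
apply: (cv g [set f | f x = g x]).
exact: (@proj_continuous _ (fun=> discrete_topology X) x _ _
  (@discrete_set1 (discrete_topology X) (g x))).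
Qed.

Lemma aut_cvg (Phi : set_system (Aut X)) g : Filter Phi ->
  (forall x, Phi [set h : Aut X | h x = g x]) -> Phi --> g.
Proof.
move=> FPhi Phig A [_ [[W oW <-] Wg] /filterS]; apply.
suff : set_val @ Phi --> (set_val g : prod_topology (fun=> discrete_topology X)).
  by apply; exact: open_nbhs_nbhs.
apply/cvg_sup => x V [_ [[B _ <-] Bg] /filterS]; apply.
move: (Phig x); apply: (@filterS _ Phi FPhi) => h hx; change (B (h x)); by rewrite hx.
Qed.

Lemma aut_ext g h : g =1 h -> g = h.
Proof. by move=> gh; apply: val_inj; exact/funext. Qed.

Lemma aut_inv g : exists h : Aut X, cancel g h /\ cancel h g.
Proof.
have [h ah [gh hg]] := automorphism_inv (autP g).
by exists (SigSub (mem_set ah)).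
Qed.

End AutTopology.

(** * Spaces that contain X as isolated points *)

Section MarkedSpaces.
Context d (X : orderType d).
Implicit Types (T K : gspace (Aut X)).

Definition isolated_copy T (i : X -> T) :=
  [/\ injective i, forall x, open [set i x] & forall g x, gact g (i x) = i (g x)].

(** Isolated points recover the permutation topology: the graph of [h] meets the open set {(i x, i
    (g x))} exactly when [h x = g x]. *)
Lemma graph_comp_is_compactification T (i : X -> T) :
  isolated_copy i -> lc_space T -> continuous (@graph_emb (Aut X) T) ->
  is_compactification (graph_comp T).
Proof.
move=> [ii io ia] lT cT; have cT' := graph_comp_emb_continuous cT.
split.
- exact: graph_comp_compact.
- exact: graph_comp_hausdorff.
- exact: graph_comp_dense.
- move=> g h [] gh; apply: aut_ext => x; apply: ii; rewrite -!ia.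
  have : @graph _ T g (i x, gact g (i x)) by [].
  by rewrite gh.
pose e := @ext_emb _ (graph_comp T).
have loc (g : Aut X) (U : set (Aut X)) : open U -> U g ->
    exists2 N, nbhs (e g) N & e @^-1` N `<=` U.
  move=> oU Ug.
  pose Phi := filter_from (nbhs (e g)) (fun N => e @^-1` N).
  have FPhi : Filter Phi.
    apply: filter_from_filter; first by exists setT; exact: filterT.
    by move=> A B eA eB; exists (A `&` B) => //; exact: filterI.
  have : Phi --> g.
    apply: aut_cvg => x; pose W : set (T * T) := [set i x] `*` [set i (g x)].
    have oW : open W by apply: open_prod.
    have : nbhs (set_val (e g)) [set F | hset F `&` W !=set0].
      by apply: nbhs_hit => //; exists (i x, i (g x)); split=> //; rewrite -ia.
    move=> /(@initial_continuous _ _ set_val (e g)) N.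
    exists (set_val @^-1` [set F | hset F `&` W !=set0]) => // h.
    move=> [[u v] [huv [/= uE vE]]]; apply: ii; rewrite -ia -uE -vE; exact: (esym huv).
  by apply; exact: open_nbhs_nbhs.
move=> U; split=> [oU|[V oV <-]]; last by apply: open_comp => // g _; exact: cT'.
exists (\bigcup_(V in [set V | open V /\ e @^-1` V `<=` U]) V).
  by apply: bigcup_open => V [].
apply/seteqP; split=> [g [V [_ VU] Vg]|g Ug]; first exact: VU.
have [N Ng NU] := loc g U oU Ug; exists N°; last exact: Ng.
by split; [exact: open_interior|move=> h /interior_subset/NU].
Qed.

(** A pointwise criterion. The first hypothesis treats open rectangles; the second says that a point
    off the graph stays off it when g and the point vary together, and compactness of C makes this
    uniform on C. *)
Lemma graph_emb_continuous T :
  (forall g (U V : set T) s, open U -> open V -> U s -> V (gact g s) ->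
     \forall h \near g, exists2 s', U s' & V (gact h s')) ->
  (forall g (s t : T), t <> gact g s ->
     \forall h \near g & p \near (s, t), p.2 <> gact h p.1) ->
  continuous (@graph_emb (Aut X) T).
Proof.
move=> hit miss g; apply: (@fell_cvg _ _ _ (fmap_filter _ (nbhs_filter g))).
  move=> W oW [[s t] [/= gst Wst]].
  have [[U V] [/= sU tV] UVW] := open_nbhs_nbhs (conj oW Wst).
  have := hit g U° V° s; rewrite -gst.
  move=> /(_ (@open_interior _ _) (@open_interior _ _) sU tV).
  apply: (@filterS _ (nbhs g) _) => h [s' /interior_subset Us' /interior_subset Vs'].
  by exists (s', gact h s'); split=> //; exact: UVW.
move=> C cC gC.
have /compact_near_coveringP/(_ _ (nbhs g)) := cC.
move=> /(_ (fun h p => p.2 <> gact h p.1) _)[].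
  move=> [s t] Cst; have [|[A B] [/= gA stB] AB] := miss g s t.
    by move=> gst; have : set0 (s, t) by rewrite -gC.
  by exists (B, A) => // -[p h] [/= Bp Ah]; exact: (AB (h, p)).
move=> A [oA Ag] h; move: (open_nbhs_nbhs (conj oA Ag)).
apply: (@filterS _ (nbhs g) _) => h' Ah'.
by apply/seteqP; split=> // p [ph' Cp]; exact: h Ah' _ Cp ph'.
Qed.

End MarkedSpaces.

(** * Limits of graphs *)

Definition flip (T : Type) (p : T * T) : T * T := (p.2, p.1).

Lemma open_embedding_flip (T : topologicalType) : open_embedding (@flip T).
Proof.
have cf : continuous (@flip T).
  by move=> p; apply: cvg_pair; [exact: cvg_snd|exact: cvg_fst].
split=> //; first by move=> [a b] [a' b'] [-> ->].
move=> U oU; rewrite (_ : _ @` _ = @flip T @^-1` U).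
  by apply: open_comp => // p _; exact: cf.
by apply/seteqP; split=> [_ [[a b] Uab <-]|[a b] Uba] //; exists (b, a).
Qed.

(** The inverse relation. It sends the graph of g to that of the inverse of g, so each statement on
    vertical lines yields its twin on horizontal lines. *)
Definition hswap (T : topologicalType) :
  hyperspace (T * T)%type -> hyperspace (T * T)%type :=
  hpreimage (open_embedding_flip T).

Section LimitGraphs.
Context d (X : orderType d).
Implicit Types T K : gspace (Aut X).

Definition limit_graph T : set (hyperspace (T * T)%type) :=
  closure (range (@graph_emb (Aut X) T)).

Definition invertible_action T := forall g, exists h,
  cancel (gact g : T -> T) (gact h) /\ cancel (gact h : T -> T) (gact g).

Definition hairs T (i : X -> T) : set (T * T) :=
  (range i `*` setT) `|` (setT `*` range i).

Lemma graph_embE T g (s t : T) : hset (graph_emb T g) (s, t) = (t = gact g s).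
Proof. by []. Qed.

Lemma hswapE T F (s t : T) : hset (hswap F) (s, t) = hset F (t, s).
Proof. by []. Qed.

(** The transfer principle: a configuration that is open at F is realised by an actual automorphism,
    where it can be refuted. *)
Lemma limit_graphP T F P : @limit_graph T F -> (\forall F' \near F, P F') ->
  exists g, P (graph_emb T g).
Proof. by move=> lF /lF[_ [[g _ <-] Pg]]; exists g. Qed.

Lemma limit_graph_hit T F (C : set (T * T)) : limit_graph F -> compact C ->
  (forall g, hset (graph_emb T g) `&` C !=set0) -> hset F `&` C !=set0.
Proof.
move=> lF cC gC; apply: contrapT => /set0P/negP/negPn/eqP FC.
have [g gC0] := limit_graphP lF (nbhs_miss cC FC).
by have := gC g; rewrite gC0 => -[].
Qed.

Lemma limit_graph_fixed T F (e : T) : limit_graph F ->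
  (forall g, gact g e = e) -> hset F (e, e).
Proof.
move=> lF ge; have [|p [Fp pe]] := limit_graph_hit lF (@compact_set1 _ (e, e)).
  by move=> g; exists (e, e); split=> //; rewrite graph_embE ge.
by rewrite -pe.
Qed.

(** The vertical line over [i x] is compact and met by every graph; missing it would be an open
    condition that no graph satisfies. *)
Lemma limit_graph_total T F (i : X -> T) x : compact [set: T] ->
  limit_graph F -> exists k, hset F (i x, k).
Proof.
move=> cT lF.
have [|[s k] [Fk [/= sx _]]] :=
    limit_graph_hit lF (compact_setX (@compact_set1 _ (i x)) cT).
  by move=> g; exists (i x, gact g (i x)).
by exists k; rewrite -sx.
Qed.

(** As [i x] is isolated, hitting {i x} x V is an open condition on the single value over [i x]. Two
    values of F would place the value of one g in arbitrary neighbourhoods of both. *)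
Lemma limit_graph_fun T F (i : X -> T) x k k' : isolated_copy i ->
  limit_graph F -> hset F (i x, k) -> hset F (i x, k') -> k = k'.
Proof.
move=> [_ io _] lF Fk Fk'; apply: (@gspace_hausdorff _ T) => A B kA kB.
have hit (V : set T) l : nbhs l V -> hset F (i x, l) ->
    \forall F' \near F, hset F' `&` ([set i x] `*` V°) !=set0.
  move=> lV Fl; apply: nbhs_hit; last by exists (i x, l).
  by apply: open_prod => //; exact: open_interior.
have [g [[[s a] [ga [/= sx /interior_subset Aa]]]
    [[t b] [gb [/= tx /interior_subset Bb]]]]] :=
  limit_graphP lF (filterI (hit _ _ kA Fk) (hit _ _ kB Fk')).
rewrite (ga : a = _) sx in Aa; rewrite (gb : b = _) tx in Bb.
by exists (gact g (i x)).
Qed.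

Lemma limit_graph_swap T F : invertible_action T -> @limit_graph T F ->
  limit_graph (hswap F).
Proof.
move=> iT lF N /(@hpreimage_continuous _ _ _ (open_embedding_flip T))/lF.
move=> [_ [[g _ <-] Ng]]; have [h [gh hg]] := iT g.
exists (graph_emb T h); split; first by exists h.
rewrite (_ : graph_emb T h = hswap (graph_emb T g)) //.
apply: hset_inj; apply/seteqP; split=> -[s t] /=.
  by rewrite hswapE !graph_embE => ->; rewrite hg.
by rewrite hswapE !graph_embE => ->; rewrite gh.
Qed.

(** * Restriction to the complement of a fixed point *)

Section OpenInvariant.
Context (U K : gspace (Aut X)) (j : U -> K) (e : K) (i : X -> K) (i' : X -> U).
Hypotheses (cK : compact [set: K]) (iK : invertible_action K)
  (je : open_embedding j) (jg : forall g u, j (gact g u) = gact g (j u))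
  (jr : range j = [set~ e]) (ge : forall g, gact g e = e)
  (ii : isolated_copy i) (ji : forall x, j (i' x) = i x)
  (approx : forall F t, limit_graph F -> hset F (e, t) ->
     t = e \/ closure (hset F `&` hairs i) (e, t)).

Let restr := hpreimage (open_embedding_sqmap je).

Fact restr_graph g : restr (graph_emb K g) = graph_emb U g.
Proof.
have [_ ji' _] := je.
apply: hset_inj; apply/seteqP; split=> -[u v]; rewrite graph_embE.
  by rewrite -[hset _ _]/(j v = gact g (j u)) -jg => /ji'.
by rewrite -[hset _ _]/(j v = gact g (j u)) -jg => ->.
Qed.

Let i_neq x : i x <> e.
Proof. by have : range j (i x) by [exists (i' x)]; rewrite jr. Qed.

Let agree (F F' : hyperspace (K * K)%type) :=
  forall s t, s <> e -> t <> e -> hset F (s, t) -> hset F' (s, t).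

(** If F takes the value e at x, then so does F': a value of F' other than e would also be a value
    of F, and F has only one value there. *)
Let agree_hairs F F' : limit_graph F -> limit_graph F' ->
  agree F F' -> agree F' F ->
  forall x k, hset F (i x, k) -> hset F' (i x, k).
Proof.
move=> lF lF' FF' F'F x k Fk.
have [ke|nke] := pselect (k = e); last exact: FF'.
have [k' F'k'] := limit_graph_total i x cK lF'.
have [k'e|nk'e] := pselect (k' = e); first by rewrite ke -k'e.
by rewrite (limit_graph_fun ii lF Fk (F'F _ _ _ nk'e F'k')).
Qed.

(** On the line over e, F lies in the closure of its hairs, up to the point (e, e) common to all
    limit graphs. Hairs of F belong to the closed set F': vertical ones by [agree_hairs], horizontal
    ones by its use on inverse relations. Points (s, e) are reduced to this case by swapping. *)
Let agree_sub F F' : limit_graph F -> limit_graph F' ->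
  agree F F' -> agree F' F -> hset F `<=` hset F'.
Proof.
have main G G' t : limit_graph G -> limit_graph G' -> agree G G' -> agree G' G ->
    hset G (e, t) -> hset G' (e, t).
  move=> lG lG' GG' G'G Ge.
  have [->|] := approx lG Ge; first exact: limit_graph_fixed.
  move=> c; apply: (@hset_closed _ G'); move: c.
  apply: closureS => -[s u] [Gsu [[/= [x _ xs] _]|[_ /= [x _ xu]]]].
    by rewrite -xs in Gsu *; exact: agree_hairs Gsu.
  rewrite -xu in Gsu *.
  have := @agree_hairs (hswap G) (hswap G') (limit_graph_swap iK lG)
    (limit_graph_swap iK lG').
  apply; [| |exact: Gsu].
    by move=> a b ? ?; apply: GG'.
  by move=> a b ? ?; apply: G'G.
move=> lF lF' FF' F'F [s t] Fst.
have [se|nse] := pselect (s = e); first by rewrite se in Fst *; exact: main Fst.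
have [te|nte] := pselect (t = e); last exact: FF'.
rewrite te in Fst *.
apply: (main (hswap F) (hswap F')) => //; try exact: limit_graph_swap.
  by move=> a b ? ?; apply: FF'.
by move=> a b ? ?; apply: F'F.
Qed.

Lemma restr_inj F F' : limit_graph F -> limit_graph F' -> restr F = restr F' ->
  F = F'.
Proof.
move=> lF lF' rFF'.
have jex s : s <> e -> exists u, j u = s.
  by move=> se; have : [set~ e] s by []; rewrite -jr => -[u _ <-]; exists u.
have ag G G' : restr G = restr G' -> agree G G'.
  move=> rGG' _ _ /jex[u <-] /jex[v <-] Guv.
  have : hset (restr G) (u, v) by [].
  by rewrite rGG'.
by apply: hset_inj; apply/seteqP; split; apply: agree_sub => //; exact: ag.
Qed.

Fact isolated_copy_restr : isolated_copy i'.
Proof.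
have [i_inj io ia] := ii; have [cj ji' _] := je; split.
- by move=> x y xy; apply: i_inj; rewrite -!ji xy.
- move=> x; rewrite (_ : [set i' x] = j @^-1` [set i x]).
    by apply: open_comp => // u _; exact: cj.
  by apply/seteqP; split=> [u ->|u]; rewrite /= -ji // => /ji'.
- by move=> g x; apply: ji'; rewrite jg !ji.
Qed.

Lemma open_invariant_comp_eq : lc_space K -> continuous (@graph_emb _ K) ->
  comp_eq (graph_comp U) (graph_comp K).
Proof.
move=> lK cgK; have cr := @hpreimage_continuous _ _ _ (open_embedding_sqmap je).
have KK := graph_comp_is_compactification ii lK cgK.
have cgU : continuous (@graph_emb _ U).
  rewrite (_ : @graph_emb _ U = restr \o @graph_emb _ K).
    by move=> g; apply: continuous_comp; [exact: cgK|exact: cr].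
  by apply/funext => g; rewrite /= restr_graph.
have KU := graph_comp_is_compactification isolated_copy_restr
  (lc_space_open_embedding je lK) cgU.
apply: comp_eq_sym.
apply: (@comp_map_inj_eq _ _ _ (graph_comp_map cr restr_graph)).
  split=> //; first exact: graph_comp_map_continuous.
  exact: graph_comp_map_emb.
move=> F F' FF'; apply: val_inj.
by apply: restr_inj (congr1 set_val FF'); exact: set_valP.
Qed.

End OpenInvariant.

(** * Passage to equivariant quotients *)

Section Quotients.
Context (K K' : gspace (Aut X)) (q : K -> K') (i : X -> K).
Hypotheses (cK : compact [set: K]) (cq : continuous q)
  (qs : range q = [set: K']) (qg : forall g s, q (gact g s) = gact g (q s))
  (ii : isolated_copy i) (ii' : isolated_copy (q \o i)).

Fact compact_sq : compact [set: K * K].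
Proof. by rewrite -setXTT; exact: compact_setX. Qed.

Fact quotient_compact : compact [set: K'].
Proof. by rewrite -qs; apply: continuous_compact cK; exact: continuous_subspaceT. Qed.

Definition push : hyperspace (K * K)%type -> hyperspace (K' * K')%type :=
  himage compact_sq
    (hausdorff_prod (@gspace_hausdorff _ K') (@gspace_hausdorff _ K'))
    (sqmap_continuous cq).

Lemma push_continuous : continuous push.
Proof. exact: himage_continuous. Qed.

Lemma push_graph g : push (graph_emb K g) = graph_emb K' g.
Proof.
apply: hset_inj; apply/seteqP; split=> [_ [[s t] gst <-]|[s' t']].
  by rewrite graph_embE in gst; rewrite graph_embE /= gst qg.
rewrite graph_embE => ->; have : range q s' by rewrite qs.
by move=> [s _ <-]; exists (s, gact g s); rewrite // /sqmap /= qg.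
Qed.

Lemma invertible_quotient : invertible_action K -> invertible_action K'.
Proof.
move=> iK g; have [h [gh hg]] := iK g; exists h.
by split=> s'; have : range q s' by [rewrite qs|rewrite qs];
  move=> [s _ <-]; rewrite -!qg ?gh ?hg.
Qed.

Hypothesis cgK : continuous (@graph_emb _ K).

Lemma quotient_graph_emb_continuous : continuous (@graph_emb _ K').
Proof.
rewrite (_ : @graph_emb _ K' = push \o @graph_emb _ K).
  by move=> g; apply: continuous_comp; [exact: cgK|exact: push_continuous].
by apply/funext => g; rewrite /= push_graph.
Qed.

Lemma quotient_is_compactification : is_compactification (graph_comp K').
Proof.
apply: graph_comp_is_compactification ii' _ quotient_graph_emb_continuous.
exact: compact_lc_space quotient_compact (@gspace_hausdorff _ K').
Qed.

Definition quotient_comp_map : graph_comp K -> graph_comp K' :=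
  graph_comp_map push_continuous push_graph.

Lemma quotient_comp_mapP : comp_map quotient_comp_map.
Proof.
split; last exact: graph_comp_map_emb.
- apply: graph_comp_is_compactification ii _ cgK.
  exact: compact_lc_space cK (@gspace_hausdorff _ K).
- exact: quotient_is_compactification.
- exact: graph_comp_map_continuous.
Qed.

(** The image of the compact space b_K G is closed and contains the dense copy of G, so it is
    everything. Properties of limit graphs on [K'] can thus be read off on [K]. *)
Lemma limit_graph_lift F' : limit_graph F' ->
  exists2 F, limit_graph F & push F = F'.
Proof.
move=> lF'; pose z : graph_comp K' := SigSub (mem_set lF').
have [y _ yz] : range quotient_comp_map z.
  by rewrite (comp_map_surj quotient_comp_mapP).
exists (set_val y); first exact: set_valP.
exact: (congr1 set_val yz).
Qed.

(** A lifted point (s, t) lies over e' in its first coordinate only, so approximation by hairs is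
    needed at every s above e' and every t; the map q x q is continuous and sends hairs to hairs. *)
Lemma quotient_approx e' :
  (forall F s t, q s = e' -> limit_graph F -> hset F (s, t) ->
     closure (hset F `&` hairs i) (s, t)) ->
  forall F' t', limit_graph F' -> hset F' (e', t') ->
    closure (hset F' `&` hairs (q \o i)) (e', t').
Proof.
move=> ap F' t' /limit_graph_lift[F lF <-] [[s t] Fst [se tt']] N.
rewrite -se -tt' => /(@sqmap_continuous _ _ _ cq (s, t)).
move=> /(ap _ _ _ se lF Fst)[[u v] [[Fuv huv] Nuv]].
exists (q u, q v); split=> //; split; first by exists (u, v).
by case: huv => [[[x _ xu] _]|[_ [x _ xv]]]; [left|right]; split=> //;
  exists x => //=; rewrite ?xu ?xv.
Qed.

End Quotients.

End LimitGraphs.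

(** * The order of b_m X *)

Section Ultrahomogeneous.
Local Open Scope order_scope.
Context d (X : orderType d).
Hypotheses (X_infinite : infinite_set [set: X]) (X_uh : ultrahomogeneous X).

Lemma uh1 (x x' : X) : exists g : Aut X, g x = x'.
Proof.
have [||g gE] := X_uh (x := fun _ : 'I_1 => x) (y := fun=> x').
- by move=> i j; rewrite !ord1.
- by move=> i j; rewrite !ord1.
by exists g; exact: gE ord0.
Qed.

Lemma uh2 (x y x' y' : X) : x < y -> x' < y' ->
  exists g : Aut X, g x = x' /\ g y = y'.
Proof.
have homo2 (u v : X) : u < v ->
    {homo (fun i : 'I_2 => if i == ord0 then u else v) : i j / (i < j)%N >-> i < j}.
  by move=> uv [[|[|//]] ?] [[|[|//]] ?].
move=> /homo2 h /homo2 h'; have [g gE] := X_uh h h'.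
by exists g; split; [exact: gE ord0|exact: gE ord_max].
Qed.

(** Moving the outer two points onto a given pair gives density; moving one point of a pair gives
    points above and below any given one. *)
Lemma uh_three : exists x y z : X, x < y /\ y < z.
Proof.
have inf (S : set X) : finite_set S -> exists x, ~ S x.
  move=> fS; apply: contrapT => h; apply: X_infinite.
  by apply: sub_finite_set fS => x _; apply: contrapT => ?; apply: h; exists x.
have [a _] := inf set0 (@finite_set0 _).
have [b ba] := inf [set a] (finite_set1 a).
have [u [v uv]] : exists u v : X, u < v.
  have [ab|ab|ab] := ltgtP a b; [by exists a, b|by exists b, a|].
  by case: ba.
have [w nw] := inf [set u; v] (finite_set2 u v).
have [wu|uw|wu] := ltgtP w u; [by exists w, u, v| |by case: nw; left].
have [wv|vw|wv] := ltgtP w v; [by exists u, w, v|by exists u, v, w|].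
by case: nw; right.
Qed.

Lemma uh_gt (x : X) : exists y, x < y.
Proof.
have [a [b [_ [ab _]]]] := uh_three; have [g <-] := uh1 a x.
by exists (g b); rewrite (automorphism_lt (autP g)).
Qed.

Lemma uh_lt (x : X) : exists y, y < x.
Proof.
have [a [b [_ [ab _]]]] := uh_three; have [g <-] := uh1 b x.
by exists (g a); rewrite (automorphism_lt (autP g)).
Qed.

Lemma uh_dense (x y : X) : x < y -> exists2 z, x < z & z < y.
Proof.
have [a [b [c [ab bc]]]] := uh_three.
move=> /(uh2 (lt_trans ab bc))[g [<- <-]].
by exists (g b); rewrite (automorphism_lt (autP g)).
Qed.

Local Notation X3 := (X *l 'I_3).
Local Notation bmo := (gapcomp X3).
Definition pt (x : X) : bm X := bpt x (@snul).
Implicit Types (u v w s t : bmo).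

Lemma bm_ltE u v : (u < v) = ~~ gapcomp_le v u.
Proof. by rewrite [LHS]ltNge. Qed.

Lemma pt_lt x y : ((pt x : bmo) < pt y) = (x < y).
Proof.
by rewrite bm_ltE /= -ltNge ltxi_pair /= ltxx implybF -ltNge; case: ltgtP.
Qed.

Lemma isolated_copy_pt : isolated_copy pt.
Proof.
split=> [x y|x|//]; last exact: center_open.
exact: bpt_inj.
Qed.

Lemma bm_act_le g u v : ((gact g (u : bm X) : bmo) <= gact g (v : bm X)) = (u <= v).
Proof. exact: gapcomp_act_mono. Qed.

Lemma bm_act_lt g u v : ((gact g (u : bm X) : bmo) < gact g (v : bm X)) = (u < v).
Proof. by rewrite !ltNge bm_act_le. Qed.

Lemma bm_invertible : invertible_action (bm X).
Proof.
move=> g; have [h [gh hg]] := aut_inv g; exists h.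
suff K (a b : Aut X) : cancel a b -> cancel (gact a : bm X -> bm X) (gact b).
  by split; exact: K.
move=> ab; have ab3 (p : X3) : aut3 b (aut3 a p) = p.
  by case: p => x r; change ((b (a x), r) = (x, r) :> X3); rewrite ab.
move=> [p|A] /=; first by congr inl; exact: ab3.
congr inr; apply: low_inj; apply/seteqP; split=> [_ [_ [p Ap <-] <-]|p Ap].
  by rewrite ab3.
by exists (aut3 a p); [exists p|exact: ab3].
Qed.

(** A gap cannot cut a fibre {x} x {-1, 0, 1}: the lower part of a proper gap has no largest
    element, and three strict steps up from (x, r) must leave a fibre of three elements. Density of
    X then gives a middle point. *)
Lemma gap_fst_gt (A : set X3) x r : gap A -> A (x, r) ->
  exists2 z, x < z & A (z, snul).
Proof.
move=> [Ad Ag] Ax.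
have [p Ap xp] : exists2 p : X3, A p & x < p.1.
  case: Ag => [A0|->|[Amax _]]; first by move: Ax; rewrite A0.
    by have [y xy] := uh_gt x; exists (y, snul).
  have next q : A q -> x <= q.1 -> exists2 q', A q' &
      x < q'.1 \/ x = q'.1 /\ (q.2 < q'.2)%N.
    move=> Aq xq; have [q' Aq' qq'] := Amax _ Aq; exists q' => //.
    move: qq'; case: q q' xq {Aq Aq'} => [y i] [y' i'] /= xy.
    rewrite ltxi_pair => /andP[yy' /implyP ii'].
    have := le_trans xy yy'; rewrite le_eqVlt => /orP[/eqP xy'|]; last by left.
    by right; split=> //; apply: ii'; rewrite -xy'.
  have [q1 Aq1 [xq1|[xq1 lt1]]] := next _ Ax (lexx _); first by exists q1.
  have [|q2 Aq2 [xq2|[xq2 lt2]]] := next _ Aq1; [by rewrite xq1|by exists q2|].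
  have [|q3 Aq3 [xq3|[_ lt3]]] := next _ Aq2; [by rewrite xq2|by exists q3|].
  by have := leq_ltn_trans (leq_ltn_trans (leq_ltn_trans (leq0n r) lt1) lt2) lt3;
    rewrite ltnNge -ltnS ltn_ord.
have [z xz zp] := uh_dense xp; exists z => //.
by apply: (Ad _ _ _ Ap); case: p zp {Ap xp} => y i /= zy; rewrite lexi_pair (ltW zy) leNgt zy.
Qed.

(** The order dual of [gap_fst_gt], descending in the complement of the lower part. *)
Lemma gap_fst_lt (A : set X3) x r : gap A -> ~ A (x, r) ->
  exists2 z, z < x & ~ A (z, snul).
Proof.
move=> [Ad Ag] Ax.
have [p Ap xp] : exists2 p : X3, ~ A p & p.1 < x.
  case: Ag => [->|AT|[_ Amin]]; last first.
  - have next q : ~ A q -> q.1 <= x -> exists2 q', ~ A q' &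
        q'.1 < x \/ x = q'.1 /\ (q'.2 < q.2)%N.
      move=> Aq xq; have [q' Aq' qq'] := Amin _ Aq; exists q' => //.
      move: qq'; case: q q' xq {Aq Aq'} => [y i] [y' i'] /= xy.
      rewrite ltxi_pair => /andP[yy' /implyP ii'].
      have := le_trans yy' xy; rewrite le_eqVlt => /orP[/eqP xy'|]; last by left.
      by right; split=> //; apply: ii'; rewrite xy'.
    have [q1 Aq1 [xq1|[xq1 lt1]]] := next _ Ax (lexx _); first by exists q1.
    have [|q2 Aq2 [xq2|[xq2 lt2]]] := next _ Aq1; [by rewrite xq1|by exists q2|].
    have [|q3 Aq3 [xq3|[_ lt3]]] := next _ Aq2; [by rewrite xq2|by exists q3|].
    by have := leq_ltn_trans (leq_ltn_trans (leq_ltn_trans (leq0n _) lt3) lt2) lt1;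
      rewrite ltnNge -ltnS ltn_ord.
  - by case: Ax; rewrite AT.
  - by have [y xy] := uh_lt x; exists (y, snul).
have [z xz zp] := uh_dense xp; exists z => // Az; apply: Ap.
apply: (Ad _ _ _ Az); case: p xz {xp} => y i /= yz.
by rewrite lexi_pair (ltW yz) leNgt yz.
Qed.

(** The weak inequalities cannot both be made strict: between (x, -1) and (x, 0) the only choice is
    x itself. *)
Lemma bm_between u v : u < v -> exists x, u <= pt x <= v.
Proof.
case: u v => [[x r]|A] [[y t]|B].
- rewrite bm_ltE /= -ltNge ltxi_pair => /andP[].
  rewrite le_eqVlt => /orP[/eqP <-|xy _].
    rewrite lexx /= => rt; exists x; rewrite !gapcomp_leE /= !lexi_pair !lexx /=.
    by move: r t rt => [[|[|[|//]]] ?] [[|[|[|//]]] ?].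
  have [z xz zy] := uh_dense xy; exists z.
  by rewrite !gapcomp_leE /= !lexi_pair !(ltW xz, ltW zy) !leNgt xz zy.
- rewrite bm_ltE /= => /negPn/set_mem Bx.
  have [z xz Bz] := gap_fst_gt (lowP B) Bx; exists z.
  by rewrite !gapcomp_leE /= !lexi_pair (ltW xz) leNgt xz /=; exact/mem_set.
- rewrite bm_ltE /= => /negP nAy.
  have [|z zy Az] := @gap_fst_lt (low A) y t (lowP A).
    by move=> Ay; apply: nAy; exact/mem_set.
  exists z; rewrite !gapcomp_leE /= !lexi_pair (ltW zy) (leNgt y z) zy andbT.
  by apply/negP => /set_mem.
rewrite bm_ltE /= => /negP nBA.
have [[x r] Bx nAx] : exists2 p, low B p & ~ low A p.
  apply: contrapT => h; apply: nBA; apply/asboolP => p Bp.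
  by apply: contrapT => nAp; apply: h; exists p.
have [z xz Bz] := gap_fst_gt (lowP B) Bx; exists z.
rewrite !gapcomp_leE /=; apply/andP; split; last exact/mem_set.
apply/negP => /set_mem Az; apply: nAx; apply: low_down Az.
by rewrite lexi_pair (ltW xz) leNgt xz.
Qed.

(** The condition on t excludes (z, 0) and (z, 1), which have immediate predecessors. *)
Lemma bm_dense_left u t : (if t is inl p then p.2 = sneg else True) ->
  u < t -> exists2 x, u < pt x & (pt x : bmo) < t.
Proof.
move=> tneg /bm_between[y /andP[uy]]; case: t tneg => [[z r]|B] /=.
  move=> ->; rewrite gapcomp_leE /= lexi_pair => /andP[yz /implyP h].
  have {h}yz : y < z by rewrite lt_neqAle yz andbT; apply/eqP => yz'; move: h;
    rewrite yz' lexx => /(_ isT).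
  have [x yx xz] := uh_dense yz; exists x.
    by apply: le_lt_trans uy _; rewrite pt_lt.
  by rewrite bm_ltE /= lexi_pair negb_and -ltNge xz.
move=> _; rewrite gapcomp_leE /= => /set_mem By.
have [x yx Bx] := gap_fst_gt (lowP B) By; exists x.
  by apply: le_lt_trans uy _; rewrite pt_lt.
by rewrite bm_ltE /= negbK; exact/mem_set.
Qed.

Lemma bm_dense_right u t : (if t is inl p then p.2 = spos else True) ->
  t < u -> exists2 x, t < pt x & (pt x : bmo) < u.
Proof.
move=> tpos /bm_between[y /andP[+ yu]]; case: t tpos => [[z r]|B] /=.
  move=> ->; rewrite gapcomp_leE /= lexi_pair => /andP[zy /implyP h].
  have {h}zy : z < y by rewrite lt_neqAle zy andbT; apply/eqP => zy'; move: h;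
    rewrite zy' lexx => /(_ isT).
  have [x zx xy] := uh_dense zy; exists x.
    by rewrite bm_ltE /= lexi_pair negb_and -ltNge zx.
  by apply: lt_le_trans yu; rewrite pt_lt.
move=> _; rewrite gapcomp_leE /= => /negP nBy.
have [|x xy Bx] := @gap_fst_lt (low B) y snul (lowP B).
  by move=> By; apply: nBy; exact/mem_set.
exists x; last by apply: lt_le_trans yu; rewrite pt_lt.
by rewrite bm_ltE /= -?topredE; apply/negP => /set_mem.
Qed.

Lemma binf_le u : (binf X : bmo) <= u. Proof. exact: gc_infP. Qed.
Lemma le_bsup u : u <= (bsup X : bmo). Proof. exact: gc_supP. Qed.

Lemma lt_bsup u : u <> bsup X -> u < (bsup X : bmo).
Proof. by move=> /eqP us; rewrite lt_neqAle us le_bsup. Qed.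

Lemma binf_lt u : u <> binf X -> (binf X : bmo) < u.
Proof. by move=> /eqP us; rewrite lt_neqAle eq_sym us binf_le. Qed.

Lemma binf_lt_pt x : (binf X : bmo) < pt x.
Proof. by rewrite bm_ltE /=; apply/negP => /set_mem. Qed.

Lemma pt_lt_bsup x : (pt x : bmo) < bsup X.
Proof. by rewrite bm_ltE /= negbK; exact/mem_set. Qed.

Lemma binf_lt_bsup : (binf X : bmo) < bsup X.
Proof.
by have [x _] := uh_three; exact: lt_trans (binf_lt_pt x) (pt_lt_bsup x).
Qed.

Lemma bm_nbhs_right t V : nbhs (t : bm X) V -> t <> bsup X ->
  exists2 b : bmo, t < b & forall w, t <= w -> w < b -> V w.
Proof.
move=> tV ts; have : nbhs (t : bmo) V by [].
rewrite itv_nbhsE => -[i [oi ti] iV].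
case: i oi ti iV => [[[] a|[]]] [[] b|[]] // _ ti iV.
- move: ti; rewrite /= in_itv /= => /andP[at_ tb]; exists b => // w tw wb.
  by apply: iV; rewrite /= in_itv /= wb (lt_le_trans at_ tw).
- move: ti; rewrite /= in_itv /= andbT => at_; exists (bsup X); first exact: lt_bsup.
  by move=> w tw _; apply: iV; rewrite /= in_itv /= (lt_le_trans at_ tw).
- move: ti; rewrite /= in_itv /= => tb; exists b => // w tw wb.
  by apply: iV; rewrite /= in_itv /= wb.
- by exists (bsup X) => [|w _ _]; [exact: lt_bsup|apply: iV].
Qed.

Lemma bm_nbhs_left t V : nbhs (t : bm X) V -> t <> binf X ->
  exists2 a : bmo, a < t & forall w, w <= t -> a < w -> V w.
Proof.
move=> tV ts; have : nbhs (t : bmo) V by [].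
rewrite itv_nbhsE => -[i [oi ti] iV].
case: i oi ti iV => [[[] a|[]]] [[] b|[]] // _ ti iV.
- move: ti; rewrite /= in_itv /= => /andP[at_ tb]; exists a => // w wt aw.
  by apply: iV; rewrite /= in_itv /= aw (le_lt_trans wt tb).
- move: ti; rewrite /= in_itv /= andbT => at_; exists a => // w wt aw.
  by apply: iV; rewrite /= in_itv /= aw.
- move: ti; rewrite /= in_itv /= => tb; exists (binf X); first exact: binf_lt.
  by move=> w wt _; apply: iV; rewrite /= in_itv /= (le_lt_trans wt tb).
- by exists (binf X) => [|w _ _]; [exact: binf_lt|apply: iV].
Qed.

Lemma pt_dense t V : nbhs (t : bm X) V -> exists x, V (pt x).
Proof.
move=> tV.
have R : (if t is inl p then p.2 = spos else True) -> t <> bsup X ->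
    exists x, V (pt x).
  move=> tpos /(bm_nbhs_right tV)[b tb bV].
  have [x tx xb] := bm_dense_right tpos tb.
  by exists x; apply: bV => //; exact: ltW.
have L : (if t is inl p then p.2 = sneg else True) -> t <> binf X ->
    exists x, V (pt x).
  move=> tneg /(bm_nbhs_left tV)[a at_ aV].
  have [x ax xt] := bm_dense_left tneg at_.
  by exists x; apply: aV => //; exact: ltW.
case: t tV R L => [[x r]|A] tV R L.
  move: r tV R L => [[|[|[|//]]] r3] tV R L.
  - by apply: L => //; exact: val_inj.
  - exists x; have := nbhs_singleton tV.
    by congr (V (inl (_, _))); exact: val_inj.
  - by apply: R => //; exact: val_inj.
(* Gaps are approached from above; only sup, with nothing above it, needs the other side. *)
have [As|] := pselect (inr A = bsup X :> bm X); last exact: R.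
by apply: L => //; rewrite As => sup_inf; have := binf_lt_bsup; rewrite sup_inf ltxx.
Qed.

(** Misses need compact test sets, hence closed intervals. If nothing lies strictly between t and
    the end of an open interval around t, the interval already stops at t, and t serves as the
    closed end. *)
Lemma bm_itv_nbhs t V : nbhs (t : bm X) V -> exists a b : bmo,
  [/\ nbhs (t : bm X) [set w : bmo | a <= w <= b] &
      forall w, a <= w -> w <= b -> V w].
Proof.
move=> tV.
have [b tb bV] : exists2 b : bmo, nbhs (t : bmo) [set w : bmo | w <= b] &
    forall w, t <= w -> w <= b -> V w.
  have [tsup|/(bm_nbhs_right tV)[b tb bV]] := pselect (t = bsup X :> bm X).
    exists t; last by move=> w tw wt; rewrite -(@le_anti _ _ t w) ?tw//; exact: nbhs_singleton.
    by apply: filterS filterT => w _; rewrite tsup; exact: le_bsup.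
  have [[w tw wb]|nw] := pselect (exists2 w : bmo, t < w & w < b).
    exists w; last by move=> u tu uw; apply: bV => //; exact: le_lt_trans wb.
    have : nbhs (t : bmo) `]-oo, w[%classic.
      by apply: open_nbhs_nbhs; split; [exact: lray_open|rewrite /= in_itv].
    by apply: filterS => u; rewrite /= in_itv /=; exact: ltW.
  exists t; last by move=> w tw wt; rewrite -(@le_anti _ _ t w) ?tw//; exact: nbhs_singleton.
  have : nbhs (t : bmo) `]-oo, b[%classic.
    by apply: open_nbhs_nbhs; split; [exact: lray_open|rewrite /= in_itv].
  apply: filterS => u; rewrite /= in_itv /= => ub.
  by rewrite leNgt; apply/negP => tu; apply: nw; exists u.
have [a ta aV] : exists2 a : bmo, nbhs (t : bmo) [set w : bmo | a <= w] &
    forall w, w <= t -> a <= w -> V w.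
  have [tinf|/(bm_nbhs_left tV)[a ta aV]] := pselect (t = binf X :> bm X).
    exists t; last by move=> w tw wt; rewrite -(@le_anti _ _ t w) ?tw ?wt//; exact: nbhs_singleton.
    by apply: filterS filterT => w _; rewrite tinf; exact: binf_le.
  have [[w aw wt]|nw] := pselect (exists2 w : bmo, a < w & w < t).
    exists w; last by move=> u tu uw; apply: aV => //; exact: lt_le_trans uw.
    have : nbhs (t : bmo) `]w, +oo[%classic.
      by apply: open_nbhs_nbhs; split; [exact: rray_open|rewrite /= in_itv /= andbT].
    by apply: filterS => u; rewrite /= in_itv /= andbT; exact: ltW.
  exists t; last by move=> w tw wt; rewrite -(@le_anti _ _ t w) ?tw ?wt//; exact: nbhs_singleton.
  have : nbhs (t : bmo) `]a, +oo[%classic.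
    by apply: open_nbhs_nbhs; split; [exact: rray_open|rewrite /= in_itv /= andbT].
  apply: filterS => u; rewrite /= in_itv /= andbT => au.
  by rewrite leNgt; apply/negP => ut; apply: nw; exists u.
exists a, b; split.
  rewrite (_ : [set _ | _] = [set w : bmo | a <= w] `&` [set w : bmo | w <= b]).
    exact: filterI ta tb.
  by apply/seteqP; split=> w /= => [/andP|[-> ->]].
move=> w aw wb; have [tw|/ltW wt] := leP t w; [exact: bV|exact: aV].
Qed.

End Ultrahomogeneous.

(** * Limits of graphs on b_m X *)

Section LimitsOnBm.
Local Open Scope order_scope.
Context d (X : orderType d).
Hypotheses (X_infinite : infinite_set [set: X]) (X_uh : ultrahomogeneous X).
Local Notation X3 := (X *l 'I_3).
Local Notation bmo := (gapcomp X3).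
Local Notation pt := (@pt d X).
Implicit Types (u v w s t : bmo) (F : hyperspace (bm X * bm X)%type).

Let bm_open_lt v : open ([set w : bmo | w < v] : set (bm X)).
Proof.
rewrite (_ : [set _ | _] = `]-oo, v[%classic); first exact: (@lray_open _ bmo).
by apply/seteqP; split=> w; rewrite /= in_itv.
Qed.

Let bm_open_gt v : open ([set w : bmo | v < w] : set (bm X)).
Proof.
rewrite (_ : [set _ | _] = `]v, +oo[%classic); first exact: (@rray_open _ bmo).
by apply/seteqP; split=> w; rewrite /= in_itv /= andbT.
Qed.

(** As [pt x] is isolated, its closed upper ray is the open ray above its lower twin. *)
Let bm_open_ge x : open ([set w : bmo | pt x <= w] : set (bm X)).
Proof.
rewrite (_ : [set _ | _] = [set w : bmo | bpt x sneg < w]) //.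
apply/seteqP; split=> w /= xw; first by apply: lt_le_trans xw; rewrite lt_twins.
rewrite leNgt; apply/negP => wx.
have wx' : w < bpt x spos by apply: lt_trans wx _; rewrite lt_twins.
by move: wx; rewrite (between_twins xw wx') ltxx.
Qed.

Let bm_open_le x : open ([set w : bmo | w <= pt x] : set (bm X)).
Proof.
rewrite (_ : [set _ | _] = [set w : bmo | w < bpt x spos]) //.
apply/seteqP; split=> w /= wx; first by apply: le_lt_trans wx _; rewrite lt_twins.
rewrite leNgt; apply/negP => xw.
have xw' : bpt x sneg < w by apply: lt_trans xw; rewrite lt_twins.
by move: xw; rewrite (between_twins xw' wx) ltxx.
Qed.

Let bm_compact_itv u v : compact ([set w : bmo | u <= w <= v] : set (bm X)).
Proof.
apply: (subclosed_compact _ (@bm_compact _ X)) => //.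
rewrite (_ : [set _ | _] = `[u, v]%classic); first exact: (@itv_closed _ bmo).
by apply/seteqP; split=> w; rewrite /= in_itv.
Qed.

Let bm_compact_ge u : compact ([set w : bmo | u <= w] : set (bm X)).
Proof.
rewrite (_ : [set _ | _] = [set w : bmo | u <= w <= bsup X]) //.
by apply/seteqP; split=> w /=; rewrite le_bsup andbT.
Qed.

Let bm_compact_le u : compact ([set w : bmo | w <= u] : set (bm X)).
Proof.
rewrite (_ : [set _ | _] = [set w : bmo | binf X <= w <= u]) //.
by apply/seteqP; split=> w /=; rewrite binf_le.
Qed.

(** Automorphisms near g agree with g at a chosen point of X. For a hit, that point is found by
    density of X. For a miss at (s, t), a point y of X separates t from g s; an h that sends the
    g-preimage of y to y keeps the two sides apart by monotonicity. *)
Lemma bm_graph_emb_continuous : continuous (@graph_emb _ (bm X)).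
Proof.
apply: graph_emb_continuous => [g U V s oU oV Us Vgs|g s t tgs].
  have [|x [Ux Vx]] := @pt_dense d X X_infinite X_uh s (U `&` gact g @^-1` V).
    apply: filterI; first exact: open_nbhs_nbhs.
    by apply: (@gact_continuous _ (bm X) g s V); exact: open_nbhs_nbhs.
  move: (aut_near g x); apply: (@filterS _ (nbhs g) _) => h hx.
  by exists (pt x) => //; change (V (pt (h x))); rewrite hx.
suff [y [A [B [sA tB AB]]]] : exists y (A B : set (bm X)), [/\ nbhs (s : bm X) A,
    nbhs (t : bm X) B & forall h : Aut X, h y = g y -> forall u v : bm X, A u -> B v ->
      v <> gact h u].
  exists ([set h : Aut X | h y = g y], A `*` B).
    by split; [exact: aut_near|exists (A, B)].
  by move=> [h [u v]] [/= hy [Au Bv]]; exact: AB.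
have [f [gf fg]] := aut_inv g.
have nb (A : set (bm X)) (w : bm X) : open A -> A w -> nbhs w A.
  by move=> oA Aw; exact: open_nbhs_nbhs.
have [tlt|gt|/esym//] := ltgtP (t : bmo) (gact g (s : bm X)).
- have [y /andP[ty ygs]] := bm_between X_infinite X_uh tlt; exists (f y).
  have zs : pt (f y) <= s by rewrite -(bm_act_le g) -[gact g _]/(pt (g (f y))) fg.
  (* The separation by y may be weak on either side, but t differs from g s, so one side is strict;
     the closed ray at a point of X is open and can be used on the other side. *)
  have [ylt|] := ltP t (pt y : bmo).
    exists [set w : bmo | pt (f y) <= w], [set w : bmo | w < pt y].
    split; [exact: nb|exact: nb|move=> h hy u v zu vy vE].
    move: vy; rewrite /= vE ltNge => /negP; apply.
    by rewrite -[y]fg -hy -[pt _]/(gact h (pt (f y))) bm_act_le.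
  move=> yt; have ygs' := le_lt_trans yt tlt.
  have zs' : pt (f y) < s by rewrite -(bm_act_lt g) -[gact g _]/(pt (g (f y))) fg.
  exists [set w : bmo | pt (f y) < w], [set w : bmo | w <= pt y].
  split; [exact: nb|exact: nb|move=> h hy u v zu vy vE].
  move: vy; rewrite /= vE leNgt => /negP; apply.
  by rewrite -[y]fg -hy -[pt _]/(gact h (pt (f y))) bm_act_lt.
- have [y /andP[gsy yt]] := bm_between X_infinite X_uh gt; exists (f y).
  have zs : s <= pt (f y) by rewrite -(bm_act_le g) -[gact g (pt _)]/(pt (g (f y))) fg.
  have [ylt|] := ltP (pt y : bmo) t.
    exists [set w : bmo | w <= pt (f y)], [set w : bmo | pt y < w].
    split; [exact: nb|exact: nb|move=> h hy u v zu vy vE].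
    move: vy; rewrite /= vE ltNge => /negP; apply.
    by rewrite -[y]fg -hy -[pt _]/(gact h (pt (f y))) bm_act_le.
  move=> ty; have gsy' := lt_le_trans gt ty.
  have zs' : s < pt (f y) by rewrite -(bm_act_lt g) -[gact g (pt _)]/(pt (g (f y))) fg.
  exists [set w : bmo | w < pt (f y)], [set w : bmo | pt y <= w].
  split; [exact: nb|exact: nb|move=> h hy u v zu vy vE].
  move: vy; rewrite /= vE leNgt => /negP; apply.
  by rewrite -[y]fg -hy -[pt _]/(gact h (pt (f y))) bm_act_lt.
Qed.

Let no_hair F (U V : set (bm X)) : ~ (exists2 p, (hset F `&` hairs pt) p & U p.1 /\ V p.2) ->
  forall C : set (bm X * bm X), C `<=` hairs pt -> C `<=` U `*` V ->
  hset F `&` C = set0.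
Proof.
move=> nh C Ch CUV; apply/seteqP; split=> // p [Fp Cp]; apply: nh.
by exists p; [split=> //; exact: Ch|exact: CUV].
Qed.

Let graph_miss g (C : set (bm X * bm X)) (s : bm X) :
  hset (graph_emb (bm X) g) `&` C = set0 -> C (s, gact g s) -> False.
Proof. by move=> gC Cs; have : set0 (s, gact g s) by rewrite -gC. Qed.

(* Limit graphs need not be approximated by hairs everywhere: if g sends points
   just above b just above c as it converges, then (b-, c+) is isolated in the
   limit. At the ends this cannot happen: inside U x V limit graph through
   (sup, t) has to meet one of the segments {a} x [y, e], [a, sup] x {y}, which
   consist of hairs. *)
Lemma bm_approx_sup F t : limit_graph F -> hset F (bsup X, t) ->
  closure (hset F `&` hairs pt) (bsup X, t).
Proof.
move=> lF Ft N [[U V] [/= sU tV] UVN].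
suff [p [Fp hp] UVp] : exists2 p, (hset F `&` hairs pt) p & U p.1 /\ V p.2.
  by exists p; split=> //; apply: UVN.
apply: contrapT => nh.
have [|a' a'sup a'U] := bm_nbhs_left sU.
  by move=> sup_inf; have := binf_lt_bsup X_infinite; rewrite sup_inf ltxx.
have [|a a'a asup] := @bm_dense_left d X X_infinite X_uh a' (bsup X) _ a'sup.
  by [].
have aU w : pt a <= w -> U w.
  by move=> aw; apply: a'U; [exact: le_bsup|exact: lt_le_trans aw].
have [c [e [tce ceV]]] := bm_itv_nbhs tV.
have [y /= /andP[cy ye]] := pt_dense X_infinite X_uh tce.
pose C1 : set (bm X * bm X) := [set pt a] `*` [set w : bmo | pt y <= w <= e].
pose C2 : set (bm X * bm X) := [set w : bmo | pt a <= w] `*` [set pt y].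
have F1 : hset F `&` C1 = set0.
  apply: (no_hair nh) => -[u v] [/= -> /andP[yv ve]].
    by left; split=> //; exists a.
  by split; [exact: aU|apply: ceV => //; exact: le_trans yv].
have F2 : hset F `&` C2 = set0.
  apply: (no_hair nh) => -[u v] [/= au ->].
    by right; split=> //; exists y.
  by split; [exact: aU|exact: ceV].
have Fh : hset F `&` [set w : bmo | pt a < w] `*` [set w : bmo | c <= w <= e]° !=set0.
  by exists (bsup X, t); split.
have [|||g [[[u v] [guv [/= au /interior_subset /andP[cv ve]]]] [g1 g2]]] :=
  limit_graphP lF (filterI (nbhs_hit _ Fh) (filterI (nbhs_miss _ F1) (nbhs_miss _ F2))).
- by apply: open_prod => //; exact: open_interior.
- exact: compact_setX (@compact_set1 _ _) _.
- by apply: compact_setX => //; exact: compact_set1.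
(* If y <= g a, then g a lies between y and v <= e, and (a, g a) is in the first segment. Otherwise
   a < w, and (w, y) is in the second. *)
have [w wy] : exists w : bm X, gact g w = pt y by exact: gapcomp_act_surj.
apply: (@graph_miss _ _ w g2); split=> //=.
have gav : (gact g (pt a) : bmo) < v by rewrite (guv : v = _) bm_act_lt.
rewrite ltW// -(bm_act_lt g) wy ltNge; apply/negP => yga.
apply: (@graph_miss _ _ (pt a) g1); split=> //=.
by rewrite yga (le_trans (ltW gav) ve).
Qed.

(** The order dual of [bm_approx_sup], with the segments {b} x [c, y] and [inf, b] x {y}. *)
Lemma bm_approx_inf F t : limit_graph F -> hset F (binf X, t) ->
  closure (hset F `&` hairs pt) (binf X, t).
Proof.
move=> lF Ft N [[U V] [/= sU tV] UVN].
suff [p [Fp hp] UVp] : exists2 p, (hset F `&` hairs pt) p & U p.1 /\ V p.2.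
  by exists p; split=> //; apply: UVN.
apply: contrapT => nh.
have [|b' infb' b'U] := bm_nbhs_right sU.
  by move=> sup_inf; have := binf_lt_bsup X_infinite; rewrite sup_inf ltxx.
have [|b infb bb'] := @bm_dense_right d X X_infinite X_uh b' (binf X) _ infb'.
  by [].
have bU w : w <= pt b -> U w.
  by move=> wb; apply: b'U; [exact: binf_le|exact: le_lt_trans wb _].
have [c [e [tce ceV]]] := bm_itv_nbhs tV.
have [y /= /andP[cy ye]] := pt_dense X_infinite X_uh tce.
pose C1 : set (bm X * bm X) := [set pt b] `*` [set w : bmo | c <= w <= pt y].
pose C2 : set (bm X * bm X) := [set w : bmo | w <= pt b] `*` [set pt y].
have F1 : hset F `&` C1 = set0.
  apply: (no_hair nh) => -[u v] [/= -> /andP[cv vy]].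
    by left; split=> //; exists b.
  by split; [exact: bU|apply: ceV => //; exact: le_trans vy ye].
have F2 : hset F `&` C2 = set0.
  apply: (no_hair nh) => -[u v] [/= ub ->].
    by right; split=> //; exists y.
  by split; [exact: bU|exact: ceV].
have Fh : hset F `&` [set w : bmo | w < pt b] `*` [set w : bmo | c <= w <= e]° !=set0.
  by exists (binf X, t); split.
have [|||g [[[u v] [guv [/= ub /interior_subset /andP[cv ve]]]] [g1 g2]]] :=
  limit_graphP lF (filterI (nbhs_hit _ Fh) (filterI (nbhs_miss _ F1) (nbhs_miss _ F2))).
- by apply: open_prod => //; exact: open_interior.
- exact: compact_setX (@compact_set1 _ _) _.
- by apply: compact_setX => //; exact: compact_set1.
have [w wy] : exists w : bm X, gact g w = pt y by exact: gapcomp_act_surj.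
apply: (@graph_miss _ _ w g2); split=> //=.
have vgb : v < gact g (pt b) by rewrite (guv : v = _) bm_act_lt.
rewrite ltW// -(bm_act_lt g) wy ltNge; apply/negP => gby.
apply: (@graph_miss _ _ (pt b) g1); split=> //=.
by rewrite gby (le_trans cv (ltW vgb)).
Qed.

Lemma bm_limit_mono F s t s' t' : limit_graph F -> hset F (s, t) ->
  hset F (s', t') -> s < s' -> t <= t'.
Proof.
(* Points u < v have neighbouring rays that are ordered as a whole: cut at a point strictly between,
   or, if u and v are adjacent, use the rays below v and above u. *)
have sep u v : u < v -> exists a b : bmo, [/\ u < b, a < v &
    forall u' v', u' < b -> a < v' -> u' < v'].
  move=> uv; have [[w uw wv]|nw] := pselect (exists2 w : bmo, u < w & w < v).
    by exists w, w; split=> // u' v'; exact: lt_trans.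
  exists u, v; split=> // u' v' u'v uv'.
  have u'u : u' <= u by rewrite leNgt; apply/negP => uu'; apply: nw; exists u'.
  exact: le_lt_trans u'u uv'.
move=> lF Fst Fst' ss'; rewrite leNgt; apply/negP => t't.
have [a [b [sb as' ab]]] := sep _ _ ss'; have [c [e [t'e ct ce]]] := sep _ _ t't.
have h1 : hset F `&` [set w : bmo | w < b] `*` [set w : bmo | c < w] !=set0.
  by exists (s, t).
have h2 : hset F `&` [set w : bmo | a < w] `*` [set w : bmo | w < e] !=set0.
  by exists (s', t').
have [||g [[[u v] [guv [/= ub cv]]] [[u' v'] [guv' [/= au' v'e]]]]] :=
  limit_graphP lF (filterI (nbhs_hit _ h1) (nbhs_hit _ h2)).
- exact: open_prod.
- exact: open_prod.
have := ce _ _ v'e cv; rewrite (guv : v = _) (guv' : v' = _) bm_act_lt => /lt_trans/(_ (ab _ _ ub au')).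
by rewrite ltxx.
Qed.

Let ends (u : bm X) := u = binf X \/ u = bsup X.

(** For (s, t) outside A_inf take x above s and y below t: graphs near F take a value above y at x,
    whereas F misses the compact set {x} x [y, sup]. Conversely the vertical hairs (x, inf) are
    dense in the bottom line, and the horizontal hairs, which must lie in A_inf, are the points
    (sup, y), dense in the line over sup. *)
Lemma A_infP F : limit_graph F ->
  (forall x k, hset F (pt x, k) -> k = binf X) -> hset F = A_inf X.
Proof.
move=> lF Finf.
have sub : hset F `<=` A_inf X.
  move=> [s t] Fst; apply: contrapT => nA.
  have ssup : s <> bsup X by move=> ss; apply: nA; right.
  have tinf : t <> binf X by move=> tt; apply: nA; left.
  have [|x sx _] := @bm_dense_left d X X_infinite X_uh s (bsup X) _ (lt_bsup ssup).
    by [].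
  have [|y _ yt] := @bm_dense_right d X X_infinite X_uh t (binf X) _ (binf_lt tinf).
    by [].
  have F1 : hset F `&` [set pt x] `*` [set w : bmo | pt y <= w] = set0.
    apply/seteqP; split=> // -[u v] [Fuv [/= ux yv]].
    rewrite ux in Fuv; move: yv; rewrite (Finf _ _ Fuv) leNgt.
    by rewrite binf_lt_pt.
  have Fh : hset F `&` [set w : bmo | w < pt x] `*` [set w : bmo | pt y < w] !=set0.
    by exists (s, t).
  have [||g [[[u v] [guv [/= ux yv]]] g1]] :=
    limit_graphP lF (filterI (nbhs_hit _ Fh) (nbhs_miss _ F1)).
  - exact: open_prod.
  - exact: compact_setX (@compact_set1 _ _) _.
  have vgx : v < gact g (pt x) by rewrite (guv : v = _) bm_act_lt.
  by apply: (@graph_miss _ _ (pt x) g1); split=> //=; exact/ltW/(lt_trans yv).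
apply/seteqP; split=> // -[s t] Ast.
apply: (@hset_closed _ F) => N [[U V] [/= sU tV] UVN].
case: Ast => -[/= e1 e2].
  have [x Ux] := pt_dense X_infinite X_uh sU.
  have [k Fk] := limit_graph_total pt x (@bm_compact _ X) lF.
  exists (pt x, k); split=> //; apply: UVN; split=> //=.
  by rewrite (Finf _ _ Fk) -e2; exact: nbhs_singleton.
have [y Vy] := pt_dense X_infinite X_uh tV.
have [k Fk] := limit_graph_total pt y (@bm_compact _ X)
  (limit_graph_swap (@bm_invertible _ X) lF).
exists (k, pt y); split=> //; apply: UVN; split=> //=.
case: (sub _ Fk) => -[/= k1 k2].
  by have := binf_lt_pt y; rewrite k2 ltxx.
by rewrite k1 -e1; exact: nbhs_singleton.
Qed.

Lemma bm_off_ends F : limit_graph F ->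
  (forall s t, ~ ends s -> ~ ends t -> ~ hset F (s, t)) ->
  hset F = A_inf X \/ hset F = A_sup X.
Proof.
move=> lF off.
have pt_ends x : ~ ends (pt x).
  case=> e; first by have := binf_lt_pt x; rewrite e ltxx.
  by have := pt_lt_bsup x; rewrite e ltxx.
have [Finf|nF] := pselect (forall x k, hset F (pt x, k) -> k = binf X).
  by left; exact: A_infP.
have [x Fx] : exists x, hset F (pt x, bsup X).
  apply: contrapT => h; apply: nF => x k Fk.
  have [//|ks] : ends k by apply: contrapT => nk; exact: off (pt_ends x) nk Fk.
  by case: h; exists x; rewrite -ks.
(* No horizontal line carries (sup, y): next to (x, sup) this would break monotonicity. So the
   inverse relation takes the value inf on all of X, and A_sup is the transpose of A_inf. *)
right; have As : hset (hswap F) = A_inf X.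
  apply: A_infP; first exact: limit_graph_swap (@bm_invertible _ X) lF.
  move=> y k; rewrite hswapE => Fk.
  have [//|ks] : ends k.
    by apply: contrapT => nk; exact: off nk (pt_ends y) Fk.
  rewrite ks in Fk; have := bm_limit_mono lF Fx Fk (pt_lt_bsup x).
  by rewrite leNgt pt_lt_bsup.
apply/seteqP; split=> -[s t]; rewrite -hswapE As.
  by case=> -[/= a b]; [left|right].
by case=> -[/= a b]; [left|right].
Qed.

(** Two ends are now possible values at x, and the common point (s0, t0) decides between them: by
    monotonicity inf is impossible to the right of s0 and sup to the left of it, and at s0 itself
    the value is t0. *)
Let bm_hairs_sub F F' s0 t0 : limit_graph F -> limit_graph F' ->
  (forall s t, ~ ends s -> ~ ends t -> hset F (s, t) -> hset F' (s, t)) ->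
  (forall s t, ~ ends s -> ~ ends t -> hset F' (s, t) -> hset F (s, t)) ->
  ~ ends s0 -> ~ ends t0 -> hset F (s0, t0) ->
  forall x k, hset F (pt x, k) -> hset F' (pt x, k).
Proof.
move=> lF lF' FF' F'F ns0 nt0 F0 x k Fk.
have pt_ends : ~ ends (pt x).
  case=> e; first by have := binf_lt_pt x; rewrite e ltxx.
  by have := pt_lt_bsup x; rewrite e ltxx.
have [ke|nk] := pselect (ends k); last exact: FF'.
have [k' F'k'] := limit_graph_total pt x (@bm_compact _ X) lF'.
have [ke'|nk'] := pselect (ends k'); last first.
  by rewrite (limit_graph_fun (@isolated_copy_pt _ X) lF Fk (F'F _ _ _ nk' F'k')).
have F'0 := FF' _ _ ns0 nt0 F0.
have no G G' : limit_graph G -> limit_graph G' -> hset G (pt x, binf X) ->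
    hset G' (pt x, bsup X) -> hset G (s0, t0) -> hset G' (s0, t0) -> False.
  move=> lG lG' Gx G'x G0 G'0.
  have [sx|xs|xs] := ltgtP (s0 : bmo) (pt x).
  - have := bm_limit_mono lG G0 Gx sx; rewrite leNgt => /negP; apply.
    by apply: binf_lt => t0i; apply: nt0; left.
  - have := bm_limit_mono lG' G'x G'0 xs; rewrite leNgt => /negP; apply.
    by apply: lt_bsup => t0i; apply: nt0; right.
  - apply: nt0; left; apply: limit_graph_fun (@isolated_copy_pt _ X) lG _ Gx.
    by rewrite -xs.
case: ke ke' => [kE [k'E|k'E]|kE [k'E|k'E]]; rewrite kE ?k'E in Fk F'k' *.
- by [].
- by case: (no F F').
- by case: (no F' F).
- by [].
Qed.

(** This determines the fibres of the map in (a), since limit graphs with equal images in b<->X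
    agree off the ends. *)
Lemma bm_dichotomy F F' : limit_graph F -> limit_graph F' ->
  (forall s t, ~ ends s -> ~ ends t -> hset F (s, t) <-> hset F' (s, t)) ->
  F = F' \/ (hset F = A_inf X \/ hset F = A_sup X) /\
            (hset F' = A_inf X \/ hset F' = A_sup X).
Proof.
move=> lF lF' FF'.
have [[[s0 t0] [ns0 nt0] F0]|off] := pselect (exists2 p : bm X * bm X,
    ~ ends p.1 /\ ~ ends p.2 & hset F p); last first.
  have nF s t : ~ ends s -> ~ ends t -> ~ hset F (s, t).
    by move=> ns nt Fst; apply: off; exists (s, t).
  right; split; apply: bm_off_ends => // s t ns nt /FF'-/(_ ns nt).
  exact: nF.
left; have {}FF' s t ns nt := FF' s t ns nt.
have sub (G G' : hyperspace (bm X * bm X)%type) : limit_graph G -> limit_graph G' -> hset G (s0, t0) ->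
    (forall s t, ~ ends s -> ~ ends t -> hset G (s, t) -> hset G' (s, t)) ->
    (forall s t, ~ ends s -> ~ ends t -> hset G' (s, t) -> hset G (s, t)) ->
    hset G `<=` hset G'.
  move=> {F F' lF lF' FF' F0} lG lG' G0 GG' G'G.
  have cl (s t : bm X) : closure (hset G `&` hairs pt) (s, t) -> hset G' (s, t).
    move=> c; apply: (@hset_closed _ G'); move: c.
    apply: closureS => -[s' u] [Gsu [[/= [x _ xs] _]|[_ /= [x _ xu]]]].
      by rewrite -xs in Gsu *; exact: (bm_hairs_sub lG lG' GG' G'G ns0 nt0 G0).
    rewrite -xu in Gsu *.
    apply: (@bm_hairs_sub (hswap G) (hswap G') t0 s0) => //;
      try exact: limit_graph_swap (@bm_invertible _ X) _.
      by move=> a b na nb; exact: GG'.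
    by move=> a b na nb; exact: G'G.
  have cl' (s t : bm X) : closure (hset (hswap G) `&` hairs pt) (t, s) -> hset G' (s, t).
    move=> c; apply: cl => N; have [cf _ _] := open_embedding_flip (bm X).
    move=> /(cf (t, s))/c[[u v] [[Guv huv] Nuv]]; exists (v, u); split=> //; split=> //.
    by case: huv => -[? ?]; [right|left].
  move=> [s t] Gst.
  have [es|ns] := pselect (ends s).
    by case: es Gst => -> Gst; apply: cl; [exact: bm_approx_inf|exact: bm_approx_sup].
  have [et|nt] := pselect (ends t); last exact: GG'.
  have lS := limit_graph_swap (@bm_invertible _ X) lG.
  by case: et Gst => -> Gst; apply: cl';
    [apply: bm_approx_inf lS _|apply: bm_approx_sup lS _].
apply: hset_inj; apply/seteqP; split; apply: sub => //; try by move=> s t ? ? /FF'; apply.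
by apply/FF'.
Qed.

(** The sets of graphs with g x < y, for x and y in X, form a filter base, and none is empty by
    homogeneity. A cluster point exists by compactness of the hyperspace and can take no value above
    inf on X. *)
Lemma limit_graph_A_inf : exists2 F, limit_graph F & hset F = A_inf X.
Proof.
pose Phi := filter_from setT
  (fun p : X * X => [set graph_emb (bm X) g | g in [set g : Aut X | g p.1 < p.2]]).
have PPhi : ProperFilter Phi.
  apply: filter_from_proper; first apply: filter_from_filter.
  - by have [x _] := uh_three X_infinite; exists (x, x).
  - move=> [x y] [x' y'] _ _; exists (Order.max x x', Order.min y y') => //.
    move=> _ [g /= gxy <-].
    have le_g (u v : X) : u <= v -> g u <= g v by have [_ ->] := autP g.
    split; exists g => //=.
      by apply: le_lt_trans (lt_le_trans gxy _);
        [apply: le_g; rewrite le_max lexx|rewrite ge_min lexx].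
    by apply: le_lt_trans (lt_le_trans gxy _);
      [apply: le_g; rewrite le_max lexx orbT|rewrite ge_min lexx orbT].
  - move=> [x y] _; have [z zy] := uh_lt X_infinite X_uh y.
    have [g gx] := uh1 X_uh x z.
    by exists (graph_emb (bm X) g); exists g => //=; rewrite gx.
have [F [_ cF]] := @hyperspace_compact (bm X * bm X)%type Phi PPhi filterT.
have lF : limit_graph F.
  move=> N FN; have [x _] := uh_three X_infinite.
  have [|G [[g _ <-] NG]] :=
    cF [set graph_emb (bm X) g | g in [set g : Aut X | g x < x]] N _ FN.
    by exists (x, x).
  by exists (graph_emb (bm X) g); split=> //; exists g.
exists F => //; apply: A_infP => // x k Fk; apply: contrapT => kinf.
have [|y _ yk] := @bm_dense_right d X X_infinite X_uh k (binf X) _ (binf_lt kinf).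
  by [].
have h : hset F `&` [set pt x] `*` [set w : bmo | pt y < w] !=set0.
  by exists (pt x, k).
have oh : open ([set pt x] `*` [set w : bmo | pt y < w] : set (bm X * bm X)).
  by apply: open_prod => //; exact: center_open.
have [|G [[g /= gxy gG]]] :=
  cF [set graph_emb (bm X) g | g in [set g : Aut X | g x < y]] _ _ (nbhs_hit oh h).
  by exists (x, y).
rewrite -gG => -[[u v] [guv [/= ux yv]]].
move: yv; rewrite (guv : v = _) ux -[gact _ _]/(pt (g x)) pt_lt.
by move=> /lt_trans/(_ gxy); rewrite ltxx.
Qed.

End LimitsOnBm.

(** * Quotients and locally compact extensions *)

Section EqvGen.
Context (T : topologicalType) (r : T -> T -> Prop).

Lemma eqv_gen_sat (E : set T) : (forall u v, r u v -> (E u <-> E v)) ->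
  forall u v, clos_refl_sym_trans T r u v -> (E u <-> E v).
Proof.
by move=> rE u v; elim=> [x y /rE|x|x y _ ->|x y z _ -> _ ->].
Qed.

Lemma eqv_gen_map (S : Type) (f : T -> S) : (forall u v, r u v -> f u = f v) ->
  forall u v, clos_refl_sym_trans T r u v -> f u = f v.
Proof.
by move=> rf u v; elim=> [x y /rf|x|x y _ ->|x y z _ -> _ ->].
Qed.

Lemma eqv_gen_fixed (E : set T) : (forall u v, r u v -> ~ E u /\ ~ E v) ->
  forall u v, clos_refl_sym_trans T r u v -> u = v \/ ~ E u /\ ~ E v.
Proof.
move=> rE u v; elim=> [x y /rE|x|x y _ [->|[? ?]]|]; [by right|by left|by left|by right|].
move=> x y z _ [->//|[Ex Ey]] _ [<-|[_ Ez]]; by right.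
Qed.

Lemma qpi_range : range (qpi r) = setT.
Proof. by apply/seteqP; split=> // a _; have [x <-] := qpi_surj a; exists x. Qed.

(* Unless f respects r, this depends on the representatives chosen by repr. *)
Definition quot_lift (S : Type) (f : T -> S) (a : quot r) : S := f (repr a).

Lemma quot_liftE (S : Type) (f : T -> S) : (forall u v, r u v -> f u = f v) ->
  forall x, quot_lift f (qpi r x) = f x.
Proof.
move=> rf x; apply: (eqv_gen_map rf).
by apply/qpiP; rewrite /qpi reprK.
Qed.

Lemma quot_lift_continuous (S : topologicalType) (f : T -> S) :
  (forall u v, r u v -> f u = f v) -> continuous f -> continuous (quot_lift f).
Proof.
move=> rf cf; apply/continuousP => V oV; rewrite quot_open.
rewrite (_ : _ @^-1` _ = f @^-1` V).
  by apply: open_comp => // x _; exact: cf.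
by apply/seteqP; split=> x; rewrite /preimage /= quot_liftE.
Qed.

Lemma quot_open_image (U : set T) : open U ->
  (forall u v, clos_refl_sym_trans T r u v -> U u -> U v) -> open (qpi r @` U).
Proof.
move=> oU sU; rewrite quot_open (_ : _ @^-1` _ = U) //.
apply/seteqP; split=> [x [u Uu /qpiP ux]|x Ux]; last by exists x.
exact: sU ux Uu.
Qed.

End EqvGen.

Lemma open_embedding_set_val (T : topologicalType) (A : set T) : open A ->
  open_embedding (set_val : set_type A -> T).
Proof.
move=> oA; split; [exact: initial_continuous|exact: val_inj|].
move=> _ [V oV <-]; rewrite (_ : _ @` _ = V `&` A); first exact: openI.
apply/seteqP; split=> [_ [u Vu <-]|x [Vx Ax]].
  by split=> //; exact: set_valP.
by exists (SigSub (mem_set Ax)).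
Qed.

Lemma range_set_val (T : Type) (A : set T) : range (set_val : set_type A -> T) = A.
Proof.
apply/seteqP; split=> [_ [u _ <-]|x Ax]; first exact: set_valP.
by exists (SigSub (mem_set Ax)).
Qed.

Lemma comp_map_quotient (G : topologicalType) (c c' : extension G) (f : c -> c') :
  comp_map f -> forall V, open V <-> open (f @^-1` V).
Proof.
move=> fm V; have [[cc _ _ _ _] [_ hc' _ _ _] cf _] := fm.
split=> [oV|ofV]; first by apply: open_comp => // x _; exact: cf.
have cV : closed (f @` (~` (f @^-1` V))).
  apply: compact_closed => //; apply: continuous_compact.
    exact: continuous_subspaceT.
  by apply: subclosed_compact cc _ => //; exact: open_closedC.
rewrite -[V]setCK; apply: closed_openC.
rewrite [X in closed X](_ : _ = f @` (~` (f @^-1` V))) //.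
apply/seteqP; split=> [y nVy|_ [x nVx <-]] //.
have [x _ xy] : range f y by rewrite (comp_map_surj fm).
by exists x => //; rewrite /preimage /= xy.
Qed.

Section Comparisons.
Local Open Scope order_scope.
Context d (X : orderType d).
Hypotheses (X_infinite : infinite_set [set: X]) (X_uh : ultrahomogeneous X).
Local Notation pt := (@pt d X).
Let ends : set (bm X) := fun u => u = binf X \/ u = bsup X.

Section PointComplement.
Context (K : gspace (Aut X)) (e : K) (i : X -> K).
Hypotheses (cK : compact [set: K]) (iK : invertible_action K)
  (ge : forall g, gact g e = e) (ii : isolated_copy i) (ie : forall x, i x <> e)
  (cgK : continuous (@graph_emb _ K))
  (approx : forall F t, limit_graph F -> hset F (e, t) ->
     t = e \/ closure (hset F `&` hairs i) (e, t)).

Lemma open_setC1 : open [set~ e].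
Proof.
apply: closed_openC; apply: accessible_closed_set1.
exact/hausdorff_accessible/gspace_hausdorff.
Qed.

(** Stated for an embedding [j], not an inclusion: Y and Z are subspaces of b_m X and of its twin
    quotient, not of b<->X and b+X. *)
Lemma point_complement_comp_eq (U : gspace (Aut X)) (j : U -> K) :
  open_embedding j -> (forall g u, j (gact g u) = gact g (j u)) ->
  range j = [set~ e] -> comp_eq (graph_comp U) (graph_comp K).
Proof.
move=> je jg jr.
have ex x : exists u, j u = i x.
  by have : [set~ e] (i x) by [exact: ie]; rewrite -jr => -[u _ <-]; exists u.
have ji x := projT2 (cid (ex x)).
apply: (open_invariant_comp_eq cK iK je jg jr ge ii ji) => //.
exact: compact_lc_space cK (@gspace_hausdorff _ K).
Qed.

Lemma setC1_comp_eq (Ainv : forall g x, [set~ e] x -> [set~ e] (gact g x)) :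
  comp_eq (graph_comp (sub_gspace Ainv)) (graph_comp K).
Proof.
apply: (@point_complement_comp_eq (sub_gspace Ainv) set_val) => //.
- exact: open_embedding_set_val open_setC1.
- exact: range_set_val.
Qed.

End PointComplement.

Let pt_ends x : ~ ends (pt x).
Proof.
case=> e; first by have := binf_lt_pt x; rewrite e ltxx.
by have := pt_lt_bsup x; rewrite e ltxx.
Qed.

Let twins_off (u v : bm X) : r_twins u v -> ~ (range pt `|` ends) u /\ ~ (range pt `|` ends) v.
Proof.
by move=> [x [-> ->]]; split=> -[[y _ []]|[//|//]] .
Qed.

Let r_ends_off (u v : bm X) : r_ends u v -> ~ (~` ends)%classic u /\ ~ (~` ends)%classic v.
Proof. by move=> [-> ->]; split=> h; apply: h; [left|right]. Qed.

Let r_both_off (u v : bm X) : r_both u v -> ~ range pt u /\ ~ range pt v.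
Proof.
case=> [[-> ->]|/twins_off[nu nv]].
  by split=> -[x _ e]; apply: (pt_ends (x := x)); [left|right].
by split=> ?; [apply: nu|apply: nv]; left.
Qed.

Let bm_cg := bm_graph_emb_continuous X_infinite X_uh.
Let bm_c := @bm_compact d X.
Let bm_i := @isolated_copy_pt d X.

(** * Quotients of b_m X that keep X isolated *)

Section IsolatedQuotient.
Context (r : bm X -> bm X -> Prop)
  (rinv : forall g u v, r u v -> r (gact g u) (gact g v))
  (rc : closed [set p : bm X * bm X | clos_refl_sym_trans (bm X) r p.1 p.2])
  (roff : forall u v, r u v -> ~ range pt u /\ ~ range pt v).
Local Notation Q := (quot_gspace rinv bm_c rc).
Local Notation q := (qpi r : bm X -> Q).

Lemma quot_gactE g s : q (gact g s) = gact g (q s).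
Proof. by rewrite [RHS](quot_actE rinv). Qed.

Lemma isolated_copy_quot : isolated_copy (q \o pt).
Proof.
have [pti pto pta] := bm_i; have fix_pt u x : clos_refl_sym_trans (bm X) r (pt x) u ->
    u = pt x.
  by move=> /(eqv_gen_fixed roff)[//|[nx _]]; case: nx; exists x.
split=> [x y /qpiP/fix_pt/pti//|x|g x]; last by rewrite -quot_gactE pta.
rewrite -(image_set1 q); apply: quot_open_image; first exact: pto.
by move=> u v + ux; rewrite [u]ux => /fix_pt.
Qed.

Let iQ := isolated_copy_quot.
Let cq : continuous q. Proof. exact: qpi_continuous. Qed.
Let qr : range q = [set: Q]. Proof. exact: qpi_range. Qed.

Definition bm_quot_map : graph_comp (bm X) -> graph_comp Q :=
  quotient_comp_map bm_c cq qr quot_gactE.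

Lemma bm_quot_mapP : comp_map bm_quot_map.
Proof. exact: (quotient_comp_mapP bm_c cq qr quot_gactE bm_i iQ bm_cg). Qed.

Lemma bm_quot_compact : compact [set: Q].
Proof. exact: quotient_compact bm_c cq qr. Qed.

Lemma bm_quot_invertible : invertible_action Q.
Proof. exact: invertible_quotient qr quot_gactE (@bm_invertible _ X). Qed.

Lemma bm_quot_graph_emb_continuous : continuous (@graph_emb _ Q).
Proof. exact: quotient_graph_emb_continuous bm_c cq qr quot_gactE bm_cg. Qed.

Lemma bm_quot_approx (e : Q) : (forall s, q s = e -> ends s) ->
  forall F t, limit_graph F -> hset F (e, t) ->
    t = e \/ closure (hset F `&` hairs (q \o pt)) (e, t).
Proof.
move=> qe F t lF Ft; right; move: F t lF Ft.
apply: (quotient_approx bm_c cq qr quot_gactE bm_i iQ bm_cg).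
by move=> F s t /qe[->|->]; [exact: bm_approx_inf|exact: bm_approx_sup].
Qed.

End IsolatedQuotient.

Let q_lr : bm X -> b_lr X := qpi (@r_ends d X).
Let q_ud : bm X -> b_ud X := qpi (@r_twins d X).
Let q_plus : bm X -> b_plus X := qpi (@r_both d X).
Let e_lr : b_lr X := q_lr (bsup X).
Let e_plus : b_plus X := q_plus (bsup X).

Let lr_off u v : @r_ends d X u v -> ~ range pt u /\ ~ range pt v.
Proof. by move=> uv; apply: r_both_off; left. Qed.

Let ud_off u v : @r_twins d X u v -> ~ range pt u /\ ~ range pt v.
Proof. by move=> uv; apply: r_both_off; right. Qed.

Let twins_ends u v : @r_twins d X u v -> (ends u <-> ends v).
Proof. by move=> /twins_off[nu nv]; split=> ?; [case: nu|case: nv]; right. Qed.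

Let ends_ends u v : @r_ends d X u v -> (ends u <-> ends v).
Proof. by move=> [-> ->]; split=> _; [right|left]. Qed.

Let both_ends u v : @r_both d X u v -> (ends u <-> ends v).
Proof. by case=> [/ends_ends|/twins_ends]. Qed.

Let lr_ends s : q_lr s = e_lr <-> ends s.
Proof.
split; first by move=> /qpiP/(eqv_gen_sat ends_ends) ->; right.
by case=> -> //; apply/qpiP/rst_step.
Qed.

Let plus_ends s : q_plus s = e_plus <-> ends s.
Proof.
split; first by move=> /qpiP/(eqv_gen_sat both_ends) ->; right.
by case=> -> //; apply/qpiP/rst_step; left.
Qed.

Let ud_end z s : ends z -> q_ud s = q_ud z <-> s = z.
Proof.
move=> ez; split; last by move=> ->.
move=> /qpiP h; have [//|[_ nz]] := eqv_gen_fixed twins_off h.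
by case: nz; right.
Qed.

Let ud_inf_eq s : q_ud s = ud_inf X <-> s = binf X.
Proof. by apply: ud_end; left. Qed.

Let ud_sup_eq s : q_ud s = ud_sup X <-> s = bsup X.
Proof. by apply: ud_end; right. Qed.

Let lr_inj s t : ~ ends s -> q_lr s = q_lr t -> s = t.
Proof.
by move=> ns /qpiP h; have [//|[]] := eqv_gen_fixed r_ends_off h.
Qed.

Let plus_ud s t : ~ ends s -> q_plus s = q_plus t -> q_ud s = q_ud t.
Proof.
move=> ns /qpiP h; apply/qpiP.
(* The two identifications do not interact: ends are not twins, so a chain of identifications runs
   through twins only or has both of its extremities among the ends. *)
suff [//|[/ns//]] : clos_refl_sym_trans (bm X) (@r_twins d X) s t \/ ends s /\ ends t.
elim: h {ns} => [u v [[-> ->]|uv]|u|u v _ [uv|[eu ev]]|u v w _ [uv|[eu ev]] _ [vw|[ev' ew]]].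
- by right; split; [left|right].
- by left; exact: rst_step.
- by left; exact: rst_refl.
- by left; exact: rst_sym.
- by right.
- by left; exact: rst_trans uv vw.
- by right; split=> //; apply/(eqv_gen_sat twins_ends uv).
- by right; split=> //; apply/(eqv_gen_sat twins_ends vw).
- by right.
Qed.

Lemma comp_eq_Yminus : comp_eq (graph_comp (Yminus X)) (graph_comp (bm X)).
Proof.
apply: (setC1_comp_eq bm_c (@bm_invertible _ X) (@bm_act_sup _ X) bm_i _ bm_cg).
  by move=> x e; apply: (@pt_ends x); right.
by move=> F t lF Ft; right; exact: bm_approx_sup.
Qed.

Lemma comp_eq_Yplus : comp_eq (graph_comp (Yplus X)) (graph_comp (bm X)).
Proof.
apply: (setC1_comp_eq bm_c (@bm_invertible _ X) (@bm_act_inf _ X) bm_i _ bm_cg).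
  by move=> x e; apply: (@pt_ends x); left.
by move=> F t lF Ft; right; exact: bm_approx_inf.
Qed.

Let ud_c : compact [set: b_ud X]. Proof. exact: bm_quot_compact. Qed.
Let ud_inv : invertible_action (b_ud X). Proof. exact: bm_quot_invertible. Qed.
Let ud_i : isolated_copy (q_ud \o pt).
Proof. by apply: isolated_copy_quot; exact: ud_off. Qed.
Let ud_cg : continuous (@graph_emb _ (b_ud X)).
Proof. exact: bm_quot_graph_emb_continuous. Qed.

Lemma comp_eq_Zminus : comp_eq (graph_comp (Zminus X)) (graph_comp (b_ud X)).
Proof.
apply: (setC1_comp_eq ud_c ud_inv (@b_ud_act_sup _ X) ud_i _ ud_cg).
  by move=> x /ud_sup_eq e; apply: (@pt_ends x); right.
apply: bm_quot_approx ud_off _ _.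
by move=> s /ud_sup_eq ->; right.
Qed.

Lemma comp_eq_Zplus : comp_eq (graph_comp (Zplus X)) (graph_comp (b_ud X)).
Proof.
apply: (setC1_comp_eq ud_c ud_inv (@b_ud_act_inf _ X) ud_i _ ud_cg).
  by move=> x /ud_inf_eq e; apply: (@pt_ends x); left.
apply: bm_quot_approx ud_off _ _.
by move=> s /ud_inf_eq ->; left.
Qed.


Lemma comp_eq_Yboth : comp_eq (graph_comp (Yboth X)) (graph_comp (b_lr X)).
Proof.
have lr_c : compact [set: b_lr X] by exact: bm_quot_compact.
have lr_inv : invertible_action (b_lr X) by exact: bm_quot_invertible.
have lr_i : isolated_copy (q_lr \o pt) by apply: isolated_copy_quot; exact: lr_off.
have lr_cg : continuous (@graph_emb _ (b_lr X)) by exact: bm_quot_graph_emb_continuous.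
have lr_ge g : gact g e_lr = e_lr.
  by rewrite -[LHS]/(gact g (q_lr _)) -quot_gactE bm_act_sup.
pose j (u : Yboth X) : b_lr X := q_lr (set_val u).
have nends (u : Yboth X) : ~ ends (set_val u).
  by have [ni ns] := set_valP u; case.
have oA : open ([set~ binf X] `&` [set~ bsup X])%classic.
  by apply: openI; exact: (@open_setC1 (bm X)).
have [vc vi vo] := open_embedding_set_val oA.
apply: (point_complement_comp_eq lr_c lr_inv lr_ge lr_i _ lr_cg _ (j := j)).
- by move=> x /lr_ends; exact: pt_ends.
- apply: bm_quot_approx lr_off _ _.
  by move=> s /lr_ends.
- split.
  + by move=> u; apply: continuous_comp; [exact: vc|exact: qpi_continuous].
  + by move=> u v /(lr_inj (nends u)); exact: val_inj.
  (* Off the ends the classes are singletons, so the image of U in b_m X is open and saturated. *)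
  + move=> U oU; rewrite (_ : j @` U = q_lr @` (set_val @` U)); last by rewrite image_comp.
    apply: quot_open_image; first exact: vo.
    move=> s t st [u Uu us]; exists u => //; apply: lr_inj; first exact: nends.
    by apply/qpiP; rewrite us.
- by move=> g u; rewrite /j -quot_gactE.
- apply/seteqP; split=> [_ [u _ <-] /lr_ends|y ny]; first exact: nends.
  have [s sy] := qpi_surj y.
  have ns : ~ ends s by move=> es; apply: ny; rewrite -sy; apply/lr_ends.
  have As : ([set~ binf X] `&` [set~ bsup X])%classic s.
    by split=> e; apply: ns; [left|right].
  by exists (SigSub (mem_set As)).
Qed.

Lemma comp_eq_Zboth : comp_eq (graph_comp (Zboth X)) (graph_comp (b_plus X)).
Proof.
have pl_c : compact [set: b_plus X] by exact: bm_quot_compact.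
have pl_inv : invertible_action (b_plus X) by exact: bm_quot_invertible.
have pl_i : isolated_copy (q_plus \o pt) by apply: isolated_copy_quot; exact: r_both_off.
have pl_cg : continuous (@graph_emb _ (b_plus X)) by exact: bm_quot_graph_emb_continuous.
have pl_ge g : gact g e_plus = e_plus.
  by rewrite -[LHS]/(gact g (q_plus _)) -quot_gactE bm_act_sup.
(* Z consists of classes of twins, so it reaches b+X through the intermediate quotient map, which
   exists because [r_twins] is contained in [r_both]. *)
pose k : b_ud X -> b_plus X := quot_lift q_plus.
have rk u v : r_twins u v -> q_plus u = q_plus v.
  by move=> uv; apply/qpiP/rst_step; right.
have kE u : k (q_ud u) = q_plus u by exact: quot_liftE.
pose j (u : Zboth X) : b_plus X := k (set_val u).
have rep (u : Zboth X) : exists2 s, ~ ends s & q_ud s = set_val u.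
  have [ni ns] := set_valP u; have [s su] := qpi_surj (set_val u).
  exists s => //; by case=> e; [apply: ni|apply: ns];
    exact: etrans (esym su) (congr1 q_ud e).
have oA : open ([set~ ud_inf X] `&` [set~ ud_sup X])%classic.
  by apply: openI; exact: (@open_setC1 (b_ud X)).
have [vc vi vo] := open_embedding_set_val oA.
apply: (point_complement_comp_eq pl_c pl_inv pl_ge pl_i _ pl_cg _ (j := j)).
- by move=> x /plus_ends; exact: pt_ends.
- apply: bm_quot_approx r_both_off _ _.
  by move=> s /plus_ends.
- split.
  + move=> u; apply: continuous_comp; [exact: vc|].
    by apply: quot_lift_continuous => //; exact: qpi_continuous.
  + move=> u v; have [s ns su] := rep u; have [t nt tv] := rep v.
    rewrite /j -su -tv !kE => /(plus_ud ns) st; apply: val_inj.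
    exact: etrans (esym su) (etrans st tv).
  + move=> U oU.
    (* Openness is seen in b_m X: the preimage of U there is open, and saturated for [r_both]
       because off the ends the classes are those of [r_twins]. *)
    rewrite (_ : j @` U = q_plus @` (q_ud @^-1` (set_val @` U))).
      apply: quot_open_image; first exact: vo.
      move=> s t st [u Uu us]; exists u => //; have [s' ns' s'u] := rep u.
      rewrite -s'u; apply: plus_ud => //; rewrite -kE s'u us kE.
      exact/qpiP.
    apply/seteqP; split=> [_ [u Uu <-]|_ [s [u Uu us] <-]].
      have [s ns su] := rep u; exists s; last by rewrite /j -su kE.
      by exists u.
    by exists u; rewrite // /j us kE.
- move=> g u; have [s ns su] := rep u.
  rewrite /j -[set_val (gact g u)]/(gact g (set_val u)) -su.
  by rewrite -quot_gactE !kE -quot_gactE.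
- apply/seteqP; split=> [_ [u _ <-]|y ny].
    have [s ns su] := rep u; rewrite /j -su kE => /plus_ends; exact: ns.
  have [s sy] := qpi_surj y.
  have ns : ~ ends s by move=> es; apply: ny; rewrite -sy; apply/plus_ends.
  have As : ([set~ ud_inf X] `&` [set~ ud_sup X])%classic (q_ud s).
    by split=> [/ud_inf_eq|/ud_sup_eq] e; apply: ns; [left|right].
  by exists (SigSub (mem_set As)); rewrite // /j kE.
Qed.

(** Treated directly, not as a quotient of b_m X. The delicate case is a miss at (None, Some y): an
    h that agrees with g at the g-preimage of y is injective, so it sends no other point to y. *)
Lemma alpha_graph_emb_continuous : continuous (@graph_emb _ (alpha X)).
Proof.
have o1 (x : X) : open ([set Some x] : set (alpha X)).
  rewrite -(image_set1 Some).
  apply: (@one_point_compactification_open_some (discrete_topology X)).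
  exact: discrete_open.
have c1 (x : X) : open ([set~ Some x] : set (alpha X)) by exact: (@open_setC1 (alpha X)).
apply: graph_emb_continuous => [g U V [x|] _ _ Us Vgs|g [x|] t tgs].
- move: (aut_near g x); apply: (@filterS _ (nbhs g) _) => h hx.
  by exists (Some x) => //; change (V (Some (h x))); rewrite hx.
- by apply: (@filterS _ (nbhs g) _ setT) => [h _|]; [exists None|exact: filterT].
- exists ([set h : Aut X | h x = g x], [set Some x] `*` [set~ Some (g x)]).
    split; first exact: aut_near.
    exists ([set Some x], [set~ Some (g x)]) => //.
    by split=> /=; apply: open_nbhs_nbhs; split.
  by move=> [h [u v]] [/= hx [-> nv]] vE; apply: nv; rewrite vE /= hx.
- case: t tgs => [y _|//]; have [f [gf fg]] := aut_inv g.
  exists ([set h : Aut X | h (f y) = g (f y)], [set~ Some (f y)] `*` [set Some y]).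
    split; first exact: aut_near.
    exists ([set~ Some (f y)], [set Some y]) => //.
    by split=> /=; apply: open_nbhs_nbhs; split.
  move=> [h [u v]] [/= hy [nu vy]] vE; apply: nu; move: vE; rewrite vy.
  case: u => [u|//] [yE]; congr Some; apply: (bij_inj (proj1 (autP h))).
  by rewrite hy fg.
Qed.

Lemma comp_eq_Xdiscrete : comp_eq (graph_comp (Xdiscrete X)) (graph_comp (alpha X)).
Proof.
have al_c : compact [set: alpha X] by exact: one_point_compactification_compact.
have al_inv : invertible_action (alpha X).
  move=> g; have [h [gh hg]] := aut_inv g; exists h.
  by split=> -[x|] //=; rewrite ?gh ?hg.
have se : open_embedding (Some : Xdiscrete X -> alpha X).
  split; first exact: one_point_compactification_some_continuous.
    by move=> x y [].
  by move=> U oU; exact: (@one_point_compactification_open_some (discrete_topology X)).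
have al_i : isolated_copy (Some : X -> alpha X).
  split=> [x y []//|x|//]; rewrite -(image_set1 Some).
  apply: (@one_point_compactification_open_some (discrete_topology X)).
  exact: discrete_open.
have := @point_complement_comp_eq (alpha X) None _ al_c al_inv _ al_i _
  alpha_graph_emb_continuous _ (Xdiscrete X) Some se; apply=> //.
(* A point (None, Some x) is itself a horizontal hair, so no limit has to be taken. *)
- move=> F [x|] lF Fx; [right|by left].
  by apply: subset_closure; split=> //; right; split=> //; exists x.
- apply/seteqP; split=> [_ [x _ <-] //|[x _|none]]; first by exists x.
  by case: none.
Qed.

(** * The map onto the graph compactification over b<->X and its fibres *)

Let f_lr : graph_comp (bm X) -> graph_comp (b_lr X) :=
  bm_quot_map (@r_ends_inv d X) (@r_ends_closed d X).

Lemma f_lr_map : comp_map f_lr.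
Proof. by apply: bm_quot_mapP; exact: lr_off. Qed.

Let f_lrP (z : graph_comp (bm X)) (s t : bm X) : hset (set_val z) (s, t) ->
  hset (set_val (f_lr z)) (q_lr s, q_lr t).
Proof. by move=> zst; exists (s, t). Qed.

Lemma f_lr_inj z z' : f_lr z = f_lr z' -> z = z' \/ zeroK X z /\ zeroK X z'.
Proof.
have sub (y y' : graph_comp (bm X)) (s t : bm X) : f_lr y = f_lr y' ->
    ~ ends s -> ~ ends t -> hset (set_val y) (s, t) -> hset (set_val y') (s, t).
  move=> yy' ns nt /f_lrP; rewrite yy' => -[[s' t'] yst' [ss' tt']].
  by rewrite (lr_inj ns (esym ss')) (lr_inj nt (esym tt')).
move=> zz'; have [|e|//] := bm_dichotomy X_infinite X_uh (set_valP z) (set_valP z').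
- by move=> s t ns nt; split; apply: sub.
- by left; exact: val_inj.
- by right.
Qed.

(** Once inf and sup become one point e, both A_inf and A_sup turn into the cross of the vertical
    and the horizontal line through (e, e). *)
Lemma f_lr_zeroK z z' : zeroK X z -> zeroK X z' -> f_lr z = f_lr z'.
Proof.
move=> Kz Kz'; apply: val_inj; apply: hset_inj.
have inf_sup : q_lr (binf X) = q_lr (bsup X) by apply/lr_ends; left.
have sub (A : set (bm X * bm X)) : A = A_inf X \/ A = A_sup X ->
    sqmap q_lr @` A = ([set: b_lr X] `*` [set e_lr]) `|` ([set e_lr] `*` [set: b_lr X]).
  move=> AE; apply/seteqP; split=> [_ [[s t] Ast <-]|[a b]].
    by case: AE Ast => -> [[/= hs ht]|[/= hs ht]];
      [left; rewrite ht|right; rewrite hs|right; rewrite hs|left; rewrite ht];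
      split; rewrite //= inf_sup.
  have [s <-] := qpi_surj a; have [t <-] := qpi_surj b.
  case: AE => -> [[/= hs ht]|[/= hs ht]].
  - by exists (s, binf X); [left|rewrite /sqmap /= inf_sup ht].
  - by exists (bsup X, t); [right|rewrite /sqmap /= hs].
  - by exists (s, bsup X); [right|rewrite /sqmap /= ht].
  - by exists (binf X, t); [left|rewrite /sqmap /= inf_sup hs].
by rewrite [LHS](sub _ Kz) [RHS](sub _ Kz').
Qed.

Lemma zeroK_A_inf : exists F : graph_space (bm X), hset (set_val F) = A_inf X.
Proof.
have [F lF FA] := limit_graph_A_inf X_infinite X_uh.
by exists (SigSub (mem_set lF)).
Qed.

Lemma zeroK_A_sup : exists F : graph_space (bm X), hset (set_val F) = A_sup X.
Proof.
have [F lF FA] := limit_graph_A_inf X_infinite X_uh.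
exists (SigSub (mem_set (limit_graph_swap (@bm_invertible _ X) lF))).
rewrite -[LHS]/(hset (hswap F)); apply/seteqP; split=> -[s t]; rewrite hswapE FA.
  by case=> -[/= ? ?]; [left|right].
by case=> -[/= ? ?]; [left|right].
Qed.

Lemma f_lr_elementary : elementary f_lr.
Proof.
have fm := f_lr_map; split; [exact: comp_map_surj|exact: comp_map_quotient|].
have [zA zAE] := zeroK_A_inf; exists (f_lr zA) => t tA.
have [z _ zt] : range f_lr t by rewrite (comp_map_surj fm).
exists z; apply/seteqP; split=> [z' /= z't|_ ->] //.
have [//|[Kz' Kz]] := f_lr_inj (etrans z't (esym zt)).
by case: tA; rewrite -zt; apply: f_lr_zeroK => //; left.
Qed.

Lemma comp_eq_collapse : comp_eq (graph_comp (b_lr X)) (collapse (zeroK X)).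
Proof.
have [_ Klr cf fE] := f_lr_map.
have rf z z' : zeroK X z /\ zeroK X z' -> f_lr z = f_lr z'.
  by move=> [Kz Kz']; exact: f_lr_zeroK.
pose h : collapse (zeroK X) -> graph_comp (b_lr X) := quot_lift f_lr.
apply: comp_eq_sym; apply: (@comp_eq_inj _ _ _ h) => //.
- rewrite -[X in compact X](qpi_range (fun z z' => zeroK X z /\ zeroK X z')).
  apply: continuous_compact (@graph_comp_compact _ (bm X)).
  by apply: continuous_subspaceT; exact: qpi_continuous.
- exact: quot_lift_continuous.
- move=> a b; have [z <-] := qpi_surj a; have [z' <-] := qpi_surj b.
  rewrite /h !quot_liftE // => /f_lr_inj[->//|KK].
  by apply/qpiP/rst_step.
- by move=> g; rewrite -fE; exact: quot_liftE.
Qed.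

End Comparisons.

Theorem theorem4p23 (d : Order.disp_t) (X : orderType d)
    (X_infinite : infinite_set [set: X]) (X_uh : ultrahomogeneous X) :
  (* (a) *)
  ((exists2 f : graph_comp (bm X) -> graph_comp (b_lr X),
      comp_map f & elementary f) /\
   [/\ exists F : graph_space (bm X), hset (set_val F) = A_inf X,
       exists F : graph_space (bm X), hset (set_val F) = A_sup X &
       comp_eq (graph_comp (b_lr X)) (collapse (zeroK X))]) /\
  (* (b) *)
  (comp_eq (graph_comp (Yminus X)) (graph_comp (Yplus X)) /\
   comp_eq (graph_comp (Yplus X)) (graph_comp (bm X))) /\
  (* (c) *)
  (comp_eq (graph_comp (Zminus X)) (graph_comp (Zplus X)) /\
   comp_eq (graph_comp (Zplus X)) (graph_comp (b_ud X))) /\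
  (* (d) *)
  comp_eq (graph_comp (Yboth X)) (graph_comp (b_lr X)) /\
  (* (e) *)
  comp_eq (graph_comp (Zboth X)) (graph_comp (b_plus X)) /\
  (* (f) *)
  comp_eq (graph_comp (Xdiscrete X)) (graph_comp (alpha X)).
Proof.
have Ym := comp_eq_Yminus X_infinite X_uh; have Yp := comp_eq_Yplus X_infinite X_uh.
have Zm := comp_eq_Zminus X_infinite X_uh; have Zp := comp_eq_Zplus X_infinite X_uh.
split; [split; [|split]|split; [split|split; [split|split; [|split]]]].
- by eexists; [exact: f_lr_map|exact: f_lr_elementary].
- exact: zeroK_A_inf.
- exact: zeroK_A_sup.
- exact: comp_eq_collapse.
- exact: comp_eq_trans Ym (comp_eq_sym Yp).
- exact: Yp.
- exact: comp_eq_trans Zm (comp_eq_sym Zp).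
- exact: Zp.
- exact: comp_eq_Yboth.
- exact: comp_eq_Zboth.
- exact: comp_eq_Xdiscrete.
Qed.
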